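(* Let $G$ be a discrete group and let $(A=\{A_p\}_{p\in G},\Delta=\{\Delta_{p,q}\}_{p,q\in G})$ be a multiplier Hopf $G$-coalgebra. Let $A_G=\bigoplus_{p\in G}A_p$. Then $A_G$ becomes a multiplier Hopf algebra under the comultiplication $\Delta_G:A_G\to M(A_G\otimes A_G)$ given by $$\Delta_G(a)(p,q)=\Delta_{p,q}(a(pq))\qquad(a\in A_G,\ p,q\in G).$$ Moreover, there exists a nondegenerate homomorphism $\gamma:K(G)\to M(A_G)$ such that $\gamma(K(G))$ is in the center of $M(A_G)$ and $\gamma$ is compatible with the comultiplication, i.e. $\Delta_G(\gamma(f))=(\gamma\otimes\gamma)(\Delta_\circ(f))$ for all $f\in K(G)$.
   Context: Algebras are associative over $\mathbb{C}$, possibly without unit, with nondegenerate product ($ab=0$ for all $a$ implies $b=0$, and $ab=0$ for all $b$ implies $a=0$). The multiplier algebra $M(A)$ consists of pairs $(L,R)$ of linear maps $A\to A$ with $L(ab)=L(a)b$, $R(ab)=aR(b)$, $R(a)b=aL(b)$; for $x=(L,R)$ write $xa=L(a)$, $ax=R(a)$; $A\otimes B\subseteq M(A)\otimes M(B)\subseteq M(A\otimes B)$. A homomorphism $\varphi:A\to M(B)$ is nondegenerate if $B$ is spanned by the elements $\varphi(a)b$ and also by the elements $b\varphi(a)$; it then extends uniquely to a homomorphism $M(A)\to M(B)$. Such extensions are used tacitly. $I$ is the identity map. Multiplier Hopf $G$-coalgebra: a family $A=\{A_p\}_{p\in G}$ of such algebras with homomorphisms $\Delta_{p,q}:A_{pq}\to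 M(A_p\otimes A_q)$ such that for all $p,q,r\in G$: (1) $\Delta_{p,q}(a)(1\otimes b)\in A_p\otimes A_q$ for $a\in A_{pq}$, $b\in A_q$, and $(a\otimes 1)\Delta_{p,q}(b)\in A_p\otimes A_q$ for $a\in A_p$, $b\in A_{pq}$; (2) $(a\otimes1\otimes1)(\Delta_{p,q}\otimes I)(\Delta_{pq,r}(b)(1\otimes c))=(I\otimes\Delta_{q,r})((a\otimes1)\Delta_{p,qr}(b))(1\otimes1\otimes c)$ for $a\in A_p$, $b\in A_{pqr}$, $c\in A_r$; (3) the maps $A_{pq}\otimes A_q\to A_p\otimes A_q$, $a\otimes b\mapsto\Delta_{p,q}(a)(1\otimes b)$, and $A_p\otimes A_{pq}\to A_p\otimes A_q$, $a\otimes b\mapsto(a\otimes1)\Delta_{p,q}(b)$, are bijective. A multiplier Hopf algebra is the case of the trivial group: a single algebra $A$ with $\Delta:A\to M(A\otimes A)$ satisfying (1)–(3). Elements of $A_G$ are finitely supported functions $a$ on $G$ with $a(p)\in A_p$, multiplied pointwise; $M(A_G\otimes A_G)$ is identified with all functions $x$ on $G\times G$ with $x(p,q)\in M(A_p\otimes A_q)$. $K(G)$ is the algebra of finitely supported complex functions on $G$ with pointwise product, and $\Delta_\circ:K(G)\to M(K(G)\otimes K(G))$ is $\Delta_\circ(f)(p,q)=f(pq)$, where $M(K(G)\otimes K(G))$ is the algebra of all complex functions on $G\times G$. *)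

(* Defs.v *)
From HB Require Import structures.
From mathcomp Require Import all_boot all_order all_algebra.
From mathcomp Require Import generic_quotient.
From mathcomp Require Import boolp classical_sets functions cardinality.

Set Implicit Arguments.
Unset Strict Implicit.
Unset Printing Implicit Defensive.
Import GRing.Theory.
Local Open Scope ring_scope.
Local Open Scope quotient_scope.

Section Bilinear.
Variables (K : fieldType) (U V W : lmodType K).

Definition bilin (f : U -> V -> W) : Prop :=
  (forall v, linear (f^~ v)) /\ (forall u, linear (f u)).

Lemma bilinP f : bilin f ->
  [/\ forall u u' v, f (u + u') v = f u v + f u' v,
      forall u v v', f u (v + v') = f u v + f u v',
      forall c u v, f (c *: u) v = c *: f u v &
      forall c u v, f u (c *: v) = c *: f u v].
Proof.
move=> [fl fr].
have f0l v : f 0 v = 0.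
  by have := fl v (-1) 0 0; rewrite scaler0 addr0 scaleN1r addNr.
have f0r u : f u 0 = 0.
  by have := fr u (-1) 0 0; rewrite scaler0 addr0 scaleN1r addNr.
split.
- by move=> u u' v; have := fl v 1 u u'; rewrite !scale1r.
- by move=> u v v'; have := fr u 1 v v'; rewrite !scale1r.
- by move=> c u v; have := fl v c u 0; rewrite f0l !addr0.
- by move=> c u v; have := fr u c v 0; rewrite f0r !addr0.
Qed.

Lemma bilin_intro f :
  (forall u u' v, f (u + u') v = f u v + f u' v) ->
  (forall u v v', f u (v + v') = f u v + f u v') ->
  (forall c u v, f (c *: u) v = c *: f u v) ->
  (forall c u v, f u (c *: v) = c *: f u v) -> bilin f.
Proof.
move=> Dl Dr Zl Zr; split => [v|u] c x y; first by rewrite Dl Zl.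
by rewrite Dr Zr.
Qed.

End Bilinear.

(* The tensor product is the quotient of the formal finite sums of pairs (u, v)
   that identifies two sums on which every bilinear map agrees.  tlift,
   tlift_tens and tensor_ind below are its universal property. *)
Section Tensor.
Variables (K : fieldType) (U V : lmodType K).
Implicit Types (W : lmodType K) (s : seq (U * V)).

Definition tsum W (f : U -> V -> W) s : W := \sum_(x <- s) f x.1 x.2.

Definition tensor_eq s s' : bool :=
  `[< forall W (f : U -> V -> W), bilin f -> tsum f s = tsum f s' >].

Lemma tensor_eq_refl : reflexive tensor_eq.
Proof. by move=> s; apply/asboolP. Qed.

Lemma tensor_eq_sym : symmetric tensor_eq.
Proof.
move=> s s'; apply/idP/idP => /asboolP e; apply/asboolP => W f bf;
  by rewrite e.
Qed.

Lemma tensor_eq_trans : transitive tensor_eq.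
Proof.
move=> s s' s'' /asboolP e /asboolP e'; apply/asboolP => W f bf.
by rewrite e // e'.
Qed.

Canonical tensor_equiv :=
  EquivRel tensor_eq tensor_eq_refl tensor_eq_sym tensor_eq_trans.

Definition tensor := {eq_quot tensor_equiv}.
HB.instance Definition _ := Choice.on tensor.

Definition tensor_of s : tensor := \pi_({eq_quot tensor_equiv}) s.

Definition tensor_rep (x : tensor) : seq (U * V) :=
  repr (x : {eq_quot tensor_equiv}).

Definition tens (u : U) (v : V) : tensor := tensor_of [:: (u, v)].

Definition tlift W (f : U -> V -> W) (x : tensor) : W := tsum f (tensor_rep x).

Lemma tensor_repK x : tensor_of (tensor_rep x) = x.
Proof. exact: reprK. Qed.

Lemma tlift_of W (f : U -> V -> W) s : bilin f ->
  tlift f (tensor_of s) = tsum f s.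
Proof.
move=> bf; have : tensor_eq (tensor_rep (tensor_of s)) s.
  by apply/eqmodP; exact: reprK.
by move=> /asboolP /(_ W f bf).
Qed.

Lemma tensor_ext (x y : tensor) :
  (forall W (f : U -> V -> W), bilin f -> tlift f x = tlift f y) -> x = y.
Proof.
move=> e; rewrite -[x]tensor_repK -[y]tensor_repK.
by apply/eqmodP/asboolP => W f bf; exact: e.
Qed.

Lemma tlift_tens W (f : U -> V -> W) u v : bilin f ->
  tlift f (tens u v) = f u v.
Proof. by move=> bf; rewrite tlift_of // /tsum big_seq1. Qed.

Definition tensor_zero := tensor_of [::].
Definition tensor_add (x y : tensor) :=
  tensor_of (tensor_rep x ++ tensor_rep y).
Definition tensor_scale c (x : tensor) :=
  tensor_of [seq (c *: z.1, z.2) | z <- tensor_rep x].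
Definition tensor_opp := tensor_scale (-1).

Let liftD W (f : U -> V -> W) x y : bilin f ->
  tlift f (tensor_add x y) = tlift f x + tlift f y.
Proof. by move=> bf; rewrite tlift_of // /tsum big_cat. Qed.

Let liftZ W (f : U -> V -> W) c x : bilin f ->
  tlift f (tensor_scale c x) = c *: tlift f x.
Proof.
move=> bf; rewrite tlift_of // /tsum big_map scaler_sumr; apply: eq_bigr => z _.
by case: (bilinP bf) => _ _ Zl _; rewrite /= Zl.
Qed.

Let lift0 W (f : U -> V -> W) : bilin f -> tlift f tensor_zero = 0.
Proof. by move=> bf; rewrite tlift_of // /tsum big_nil. Qed.

Let addA : associative tensor_add.
Proof. by move=> x y z; apply: tensor_ext => W f bf; rewrite !liftD // addrA. Qed.

Let addC : commutative tensor_add.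
Proof. by move=> x y; apply: tensor_ext => W f bf; rewrite !liftD // addrC. Qed.

Let add0 : left_id tensor_zero tensor_add.
Proof.
by move=> x; apply: tensor_ext => W f bf; rewrite liftD // lift0 // add0r.
Qed.

Let addN : left_inverse tensor_zero tensor_opp tensor_add.
Proof.
move=> x; apply: tensor_ext => W f bf.
by rewrite liftD // lift0 // liftZ // scaleN1r addNr.
Qed.

HB.instance Definition _ := GRing.isZmodule.Build tensor addA addC add0 addN.

Let scaleA c d x : tensor_scale c (tensor_scale d x) = tensor_scale (c * d) x.
Proof. by apply: tensor_ext => W f bf; rewrite !liftZ // scalerA. Qed.

Let scale1 : left_id 1 tensor_scale.
Proof. by move=> x; apply: tensor_ext => W f bf; rewrite liftZ // scale1r. Qed.

Let scaleDr : right_distributive tensor_scale +%R.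
Proof.
by move=> c x y; apply: tensor_ext => W f bf; rewrite liftZ // !liftD // !liftZ // scalerDr.
Qed.

Let scaleDl x : {morph tensor_scale^~ x : c d / c + d}.
Proof.
by move=> c d; apply: tensor_ext => W f bf; rewrite liftD // !liftZ // scalerDl.
Qed.

HB.instance Definition _ := GRing.Zmodule_isLmodule.Build K tensor
  scaleA scale1 scaleDr scaleDl.

Lemma tlift_linear W (f : U -> V -> W) : bilin f -> linear (tlift f).
Proof. by move=> bf c x y; rewrite [LHS]liftD // liftZ. Qed.

Lemma tlift0 W (f : U -> V -> W) : bilin f -> tlift f 0 = 0.
Proof. exact: lift0. Qed.
Lemma tliftD W (f : U -> V -> W) : bilin f -> {morph tlift f : x y / x + y}.
Proof. by move=> bf x y; exact: liftD. Qed.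
Lemma tliftZ W (f : U -> V -> W) c : bilin f -> {morph tlift f : x / c *: x}.
Proof. by move=> bf x; exact: liftZ. Qed.

Lemma tens_bilin : bilin tens.
Proof.
apply: bilin_intro => *; apply: tensor_ext => W f bf;
  have [Dl Dr Zl Zr] := bilinP bf;
  by rewrite ?tliftD // ?tliftZ // !tlift_tens.
Qed.

Lemma tensor_ind (P : tensor -> Prop) :
  P 0 -> (forall u v, P (tens u v)) -> (forall x y, P x -> P y -> P (x + y)) ->
  forall x, P x.
Proof.
move=> P0 Pt PD x; rewrite -[x]tensor_repK.
elim: (tensor_rep x) => [//|[u v] s IHs].
suff -> : tensor_of ((u, v) :: s) = tens u v + tensor_of s by exact: PD.
apply: tensor_ext => W f bf.
by rewrite tliftD // tlift_tens // !tlift_of // /tsum big_cons.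
Qed.

End Tensor.


Section LinearPred.
Variables (K : fieldType) (U V : lmodType K) (f : U -> V).
Hypothesis lf : linear f.

Lemma lin0 : f 0 = 0.
Proof. by have := lf (-1) 0 0; rewrite scaler0 addr0 scaleN1r addNr. Qed.
Lemma linD x y : f (x + y) = f x + f y.
Proof. by have := lf 1 x y; rewrite !scale1r. Qed.
Lemma linZ c x : f (c *: x) = c *: f x.
Proof. by have := lf c x 0; rewrite lin0 !addr0. Qed.

End LinearPred.

Section TensorMaps.
Variable K : fieldType.
Implicit Types U V W X : lmodType K.

Lemma tensor_eqfun U V W (f g : tensor U V -> W) : linear f -> linear g ->
  (forall u v, f (tens u v) = g (tens u v)) -> f =1 g.
Proof.
move=> lf lg e; elim/tensor_ind => [|//|x y ex ey]; first by rewrite !lin0.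
by rewrite !linD // ex ey.
Qed.

Lemma tlift_param U V W X (f : X -> U -> V -> W) (t : tensor U V) :
  (forall x, bilin (f x)) -> (forall u v, linear (fun x => f x u v)) ->
  linear (fun x => tlift (f x) t).
Proof.
move=> bf lf c x y; elim/tensor_ind: t => [|u v|s t es et].
- by rewrite !tlift0 // scaler0 addr0.
- by rewrite !tlift_tens // lf.
- by rewrite !tliftD // es et scalerDr addrACA.
Qed.

(* f (x) g *)
Definition tmap U V U' V' (f : U -> U') (g : V -> V') :
    tensor U V -> tensor U' V' :=
  tlift (fun u v => tens (f u) (g v)).

Lemma tmap_bilin U V U' V' (f : U -> U') (g : V -> V') :
  linear f -> linear g -> bilin (fun u v => tens (f u) (g v)).
Proof.
move=> lf lg; have [Dl Dr Zl Zr] := bilinP (tens_bilin U' V').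
by apply: bilin_intro => *; rewrite ?(linD lf) ?(linD lg) ?(linZ lf) ?(linZ lg) ?Dl ?Dr ?Zl ?Zr.
Qed.

Lemma tmap_tens U V U' V' (f : U -> U') (g : V -> V') u v :
  linear f -> linear g -> tmap f g (tens u v) = tens (f u) (g v).
Proof. by move=> lf lg; rewrite /tmap tlift_tens //; exact: tmap_bilin. Qed.

Lemma tmap_linear U V U' V' (f : U -> U') (g : V -> V') :
  linear f -> linear g -> linear (tmap f g).
Proof. by move=> lf lg; apply: tlift_linear; exact: tmap_bilin. Qed.

Definition tassoc U V W : tensor (tensor U V) W -> tensor U (tensor V W) :=
  tlift (fun t w => tlift (fun u v => tens u (tens v w)) t).

Let tassoc_bilin1 U V W w :
  bilin (fun (u : U) (v : V) => tens u (tens v (w : W))).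
Proof.
have [Dl Dr Zl Zr] := bilinP (tens_bilin U (tensor V W)).
have [Dl' Dr' Zl' Zr'] := bilinP (tens_bilin V W).
by apply: bilin_intro => *; rewrite ?(Dl, Zl) // (Dl', Zl') (Dr, Zr).
Qed.

Lemma tassoc_tens U V W (u : U) (v : V) (w : W) :
  tassoc (tens (tens u v) w) = tens u (tens v w).
Proof.
rewrite /tassoc tlift_tens ?tlift_tens //.
split => [w'|t]; first exact/tlift_linear/tassoc_bilin1.
apply: (@tlift_param U V (tensor U (tensor V W)) W) => [w'|u' v' c x y].
  exact: tassoc_bilin1.
by rewrite (tens_bilin _ _).2 (tens_bilin _ _).2.
Qed.

End TensorMaps.

(* Associative algebras over K without a unit in general. *)
HB.mixin Record Lmodule_isNonUnitalAlg (K : fieldType) A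
    of GRing.Lmodule K A := {
  nmul : A -> A -> A;
  nmulA : associative nmul;
  nmul_linl : forall b, linear (nmul^~ b);
  nmul_linr : forall a, linear (nmul a)
}.

#[short(type="nualgType")]
HB.structure Definition NonUnitalAlg (K : fieldType) :=
  {A of Lmodule_isNonUnitalAlg K A & GRing.Lmodule K A}.

Notation "a ** b" := (nmul a b) (at level 40, left associativity) : ring_scope.

Section AlgTheory.
Variables (K : fieldType) (A : nualgType K).
Implicit Types a b : A.

Lemma nmul_bilin : bilin (@nmul K A).
Proof. by split; [exact: nmul_linl | exact: nmul_linr]. Qed.

Definition nondegenerate : Prop :=
  (forall b, (forall a, a ** b = 0) -> b = 0) /\
  (forall a, (forall b, a ** b = 0) -> a = 0).

End AlgTheory.
Arguments nondegenerate {K} A.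

Definition is_hom (K : fieldType) (A B : nualgType K) (f : A -> B) : Prop :=
  linear f /\ forall a b, f (a ** b) = f a ** f b.

Section ScalarAlg.
Variable K : fieldType.

Let mul_linl (b : K^o) : linear (fun a : K^o => (a * b : K^o)).
Proof. by move=> c x y; rewrite /GRing.scale /= mulrDl mulrA. Qed.
Let mul_linr (a : K^o) : linear (fun b : K^o => (a * b : K^o)).
Proof. by move=> c x y; rewrite /GRing.scale /= mulrDr mulrCA. Qed.

HB.instance Definition _ := Lmodule_isNonUnitalAlg.Build K K^o
  (@mulrA K) mul_linl mul_linr.

End ScalarAlg.

Section TensorAlg.
Variables (K : fieldType) (A B : nualgType K).

Definition tensor_mul (x y : tensor A B) : tensor A B :=
  tlift (fun a b => tmap (nmul a) (nmul b) y) x.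

Let mul_bilin1 (y : tensor A B) :
  bilin (fun (a : A) (b : B) => tmap (nmul a) (nmul b) y).
Proof.
  split => [b|a].
    apply: (@tlift_param K A B _ A) => [a|a' b' c x z].
      exact/tmap_bilin/nmul_linr/nmul_linr.
    by rewrite nmul_linl (tens_bilin _ _).1.
  apply: (@tlift_param K A B _ B) => [b|a' b' c x z].
    exact/tmap_bilin/nmul_linr/nmul_linr.
  by rewrite nmul_linl (tens_bilin _ _).2.
Qed.

Lemma tensor_mul_bilin : bilin tensor_mul.
Proof.
split => [y|x]; first exact/tlift_linear/mul_bilin1.
apply: (@tlift_param K A B _ (tensor A B)) => // a b.
exact/tmap_linear/nmul_linr/nmul_linr.
Qed.

Lemma tensor_mul_tens a b a' b' :
  tensor_mul (tens a b) (tens a' b') = tens (a ** a') (b ** b').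
Proof.
rewrite /tensor_mul tlift_tens; last exact: mul_bilin1.
by rewrite tmap_tens; [|exact: nmul_linr..].
Qed.

Let tensor_mulA : associative tensor_mul.
Proof.
move=> x y z.
have [Dl Dr _ _] := bilinP tensor_mul_bilin.
have l0 y' : tensor_mul 0 y' = 0 by exact/(lin0 (tensor_mul_bilin.1 y')).
have r0 x' : tensor_mul x' 0 = 0 by exact/(lin0 (tensor_mul_bilin.2 x')).
elim/tensor_ind: x => [|a b|x x' ex ex']; first by rewrite !l0.
- elim/tensor_ind: y => [|a' b'|y y' ey ey']; first by rewrite !(l0, r0).
  + elim/tensor_ind: z => [|a'' b''|z z' ez ez']; first by rewrite !r0.
    * by rewrite !tensor_mul_tens !nmulA.
    * by rewrite !Dr ez ez'.
  + by rewrite !(Dl, Dr) ey ey'.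
- by rewrite !Dl ex ex'.
Qed.

HB.instance Definition _ := Lmodule_isNonUnitalAlg.Build K (tensor A B)
  tensor_mulA tensor_mul_bilin.1 tensor_mul_bilin.2.

Lemma tens_mul (a a' : A) (b b' : B) :
  tens a b ** tens a' b' = tens (a ** a') (b ** b') :> tensor A B.
Proof. exact: tensor_mul_tens. Qed.

End TensorAlg.

(* A multiplier x = (L, R) acts by xa = L(a) and ax = R(a). *)
Definition is_multiplier (K : fieldType) (A : nualgType K)
    (LR : (A -> A) * (A -> A)) : Prop :=
  [/\ linear LR.1, linear LR.2,
      forall a b, LR.1 (a ** b) = LR.1 a ** b,
      forall a b, LR.2 (a ** b) = a ** LR.2 b &
      forall a b, LR.2 a ** b = a ** LR.1 b].

Definition multiplier_pred (K : fieldType) (A : nualgType K) :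
  {pred (A -> A) * (A -> A)} := fun LR => `[< is_multiplier LR >].

Section MultiplierClosed.
Variables (K : fieldType) (A : nualgType K).

Let closed : submod_closed (@multiplier_pred K A).
Proof.
have [Dl Dr Zl Zr] := bilinP (@nmul_bilin K A).
split=> [|c x y /asboolP[lx1 lx2 xl xr xm] /asboolP[ly1 ly2 yl yr ym]].
  have z b : 0 ** b = 0 :> A by exact: (lin0 (nmul_linl b)).
  have z' b : b ** 0 = 0 :> A by exact: (lin0 (nmul_linr b)).
  suff: @is_multiplier K A (fun=> 0, fun=> 0) by move=> ?; apply/asboolP.
  by split=> [c x y|c x y|a b|a b|a b] /=; rewrite ?scaler0 ?addr0 ?z ?z'.
suff: @is_multiplier K A
  (fun a => c *: x.1 a + y.1 a, fun a => c *: x.2 a + y.2 a).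
  by move=> ?; apply/asboolP.
split=> [d a b|d a b|a b|a b|a b] /=.
- by rewrite lx1 ly1 !scalerDr !scalerA [c * d]mulrC addrACA.
- by rewrite lx2 ly2 !scalerDr !scalerA [c * d]mulrC addrACA.
- by rewrite xl yl Dl Zl.
- by rewrite xr yr Dr Zr.
- by rewrite Dl Zl Dr Zr xm ym.
Qed.

HB.instance Definition _ := GRing.isSubmodClosed.Build K _ _ closed.

End MultiplierClosed.

(* M(A) *)
Record multiplier (K : fieldType) (A : nualgType K) := Multiplier {
  mult_pair : (A -> A) * (A -> A);
  _ : mult_pair \in @multiplier_pred K A
}.

Section Multiplier.
Variables (K : fieldType) (A : nualgType K).

HB.instance Definition _ := [isSub for @mult_pair K A].
HB.instance Definition _ := [Choice of multiplier A by <:].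
HB.instance Definition _ := [SubChoice_isSubLmodule of multiplier A by <:].

Implicit Types x y : multiplier A.

Definition multL x : A -> A := (mult_pair x).1.
Definition multR x : A -> A := (mult_pair x).2.

Lemma multP x : is_multiplier (multL x, multR x).
Proof. by case: x => -[L R] LR; apply/asboolP. Qed.

Definition mk_mult (L R : A -> A) (LR : is_multiplier (L, R)) : multiplier A :=
  Multiplier (asboolT LR).

Lemma mult_eq x y : multL x =1 multL y -> multR x =1 multR y -> x = y.
Proof.
move=> eL eR; apply: val_inj; apply: injective_projections; exact/funext.
Qed.

Lemma multLP c x y a : multL (c *: x + y) a = c *: multL x a + multL y a.
Proof. by []. Qed.
Lemma multRP c x y a : multR (c *: x + y) a = c *: multR x a + multR y a.
Proof. by []. Qed.

Let one_is_mult : is_multiplier (@idfun A, @idfun A).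
Proof. by []. Qed.

Definition mult_one : multiplier A := mk_mult one_is_mult.

Let comp_is_mult x y :
  is_multiplier (multL x \o multL y, multR y \o multR x).
Proof.
have [/= Lx Rx LMx RMx Mx] := multP x; have [/= Ly Ry LMy RMy My] := multP y.
split=> [c a b|c a b|a b|a b|a b] /=.
- by rewrite Ly Lx.
- by rewrite Rx Ry.
- by rewrite LMy LMx.
- by rewrite RMx RMy.
- by rewrite My Mx.
Qed.

(* a(xy) = (ax)y, hence the reversed order on the right multiplications *)
Definition mult_mul x y : multiplier A := mk_mult (comp_is_mult x y).

Let mult_mulA : associative mult_mul.
Proof. by move=> x y z; apply: mult_eq. Qed.

Let mult_mull y : linear (mult_mul^~ y).
Proof.
have [/= _ lR _ _ _] := multP y.
by move=> c x x'; apply: mult_eq => a //=; exact: lR.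
Qed.

Let mult_mulr x : linear (mult_mul x).
Proof.
have [/= lL _ _ _ _] := multP x.
by move=> c y y'; apply: mult_eq => a //=; exact: lL.
Qed.

HB.instance Definition _ := Lmodule_isNonUnitalAlg.Build K (multiplier A)
  mult_mulA mult_mull mult_mulr.

Let emb_is_mult (a : A) : is_multiplier (nmul a, nmul^~ a).
Proof.
by split; [exact: nmul_linr | exact: nmul_linl | | |] => b c /=;
  rewrite !nmulA.
Qed.

(* The canonical map A -> M(A), injective when A is nondegenerate. *)
Definition emb (a : A) : multiplier A := mk_mult (emb_is_mult a).

End Multiplier.
Arguments mult_one {K A}.
Notation "1%M" := mult_one : ring_scope.

Section MultTensor.
Variables (K : fieldType) (A B : nualgType K).

Let tens_is_mult (x : multiplier A) (y : multiplier B) : is_multiplier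
  (tmap (multL x) (multL y) : tensor A B -> tensor A B,
   tmap (multR x) (multR y) : tensor A B -> tensor A B).
Proof.
have [/= Lx Rx LMx RMx Mx] := multP x; have [/= Ly Ry LMy RMy My] := multP y.
have mL a := @nmul_linl K (tensor A B) a.
have mR a := @nmul_linr K (tensor A B) a.
have tL := tmap_linear Lx Ly; have tR := tmap_linear Rx Ry.
split => // s t /=.
- elim/tensor_ind: s => [|a b|s s' es es'];
    rewrite ?(lin0 tL) ?(lin0 (mL _)) ?(lin0 tL) //.
  + elim/tensor_ind: t => [|a' b'|t t' et et'].
    * by rewrite !(lin0 (mR _)) (lin0 tL).
    * by rewrite tens_mul !tmap_tens // tens_mul LMx LMy.
    * by rewrite !(linD (mR _)) (linD tL) et et'.
  + by rewrite (linD (mL _)) !(linD tL) (linD (mL _)) es es'.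
- elim/tensor_ind: t => [|a' b'|t t' et et'].
  + by rewrite (lin0 tR) !(lin0 (mR _)) (lin0 tR).
  + elim/tensor_ind: s => [|a b|s s' es es'].
    * by rewrite !(lin0 (mL _)) (lin0 tR).
    * by rewrite tens_mul !tmap_tens // tens_mul RMx RMy.
    * by rewrite !(linD (mL _)) (linD tR) es es'.
  + by rewrite (linD (mR _)) !(linD tR) (linD (mR _)) et et'.
- elim/tensor_ind: s => [|a b|s s' es es'].
  + by rewrite (lin0 tR) !(lin0 (mL _)).
  + elim/tensor_ind: t => [|a' b'|t t' et et'].
    * by rewrite (lin0 tL) !(lin0 (mR _)).
    * by rewrite !tmap_tens // !tens_mul Mx My.
    * by rewrite (linD tL) !(linD (mR _)) et et'.
  + by rewrite (linD tR) !(linD (mL _)) es es'.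
Qed.

(* M(A) (x) M(B) -> M(A (x) B) on elementary tensors *)
Definition mtens (x : multiplier A) (y : multiplier B) :
  multiplier (tensor A B) := mk_mult (tens_is_mult x y).

End MultTensor.

(* f (x) g followed by M(A') (x) M(B') -> M(A' (x) B') *)
Definition tensor_hom (K : fieldType) (A B A' B' : nualgType K)
    (f : A -> multiplier A') (g : B -> multiplier B') :
    tensor A B -> multiplier (tensor A' B') :=
  tlift (fun a b => mtens (f a) (g b)).

(* y is x read through h: h(xa) = y h(a) and h(ax) = h(a) y *)
Definition intertwines (K : fieldType) (A B : nualgType K) (h : A -> B)
    (x : multiplier A) (y : multiplier B) : Prop :=
  forall a, h (multL x a) = multL y (h a) /\ h (multR x a) = multR y (h a).

Definition spanning (K : fieldType) (V : lmodType K) (I : Type) (g : I -> V) :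
    Prop :=
  forall v, exists s : seq (K * I), v = \sum_(z <- s) z.1 *: g z.2.

Definition nondegenerate_hom (K : fieldType) (A B : nualgType K)
    (f : A -> multiplier B) : Prop :=
  [/\ is_hom f,
      spanning (fun ab : A * B => multL (f ab.1) ab.2) &
      spanning (fun ab : A * B => multR (f ab.1) ab.2)].

(* F is the extension to M(A) of the nondegenerate homomorphism f; it is unique
   by is_extension_uniq. *)
Definition is_extension (K : fieldType) (A B : nualgType K)
    (f : A -> multiplier B) (F : multiplier A -> multiplier B) : Prop :=
  [/\ nondegenerate_hom f, is_hom F & forall a, F (emb a) = f a].

Section Extension.
Variables (K : fieldType) (A B : nualgType K).

Lemma mult_emb (x : multiplier A) a : x ** emb a = emb (multL x a).
Proof.
have [/= _ _ LM _ Mx] := multP x.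
by apply: mult_eq => b /=; [exact: LM | exact: Mx].
Qed.

Lemma emb_mult (x : multiplier A) a : emb a ** x = emb (multR x a).
Proof.
have [/= _ _ _ RM Mx] := multP x.
by apply: mult_eq => b /=; [symmetry; exact: Mx | exact: RM].
Qed.

Lemma is_extension_uniq (f : A -> multiplier B) F F' :
  is_extension f F -> is_extension f F' -> F =1 F'.
Proof.
move=> [[_ sL sR] [_ FM] Fe] [_ [_ FM'] Fe'] x.
have span_eq (g h : B -> B) I (k : I -> B) : linear g -> linear h ->
    spanning k -> (forall i, g (k i) = h (k i)) -> g =1 h.
  move=> lg lh sk e b; have [s ->] := sk b.
  elim: s => [|z s IHs]; first by rewrite big_nil !lin0.
  by rewrite big_cons lg lh e IHs.
have [/= L1 R1 _ _ _] := multP (F x); have [/= L2 R2 _ _ _] := multP (F' x).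
apply: mult_eq.
  apply: (span_eq _ _ _ _ L1 L2 sL) => -[a b] /=.
  have e : F x ** f a = F' x ** f a.
    by rewrite -{1}Fe -Fe' -FM -FM' mult_emb Fe Fe'.
  exact: (congr1 (fun y => multL y b) e).
apply: (span_eq _ _ _ _ R1 R2 sR) => -[a b] /=.
have e : f a ** F x = f a ** F' x.
  by rewrite -{1}Fe -Fe' -FM -FM' emb_mult Fe Fe'.
exact: (congr1 (fun y => multR y b) e).
Qed.

End Extension.

(* The algebra of finitely supported sections of a family of algebras. *)
Section DirectSum.
Variables (K : fieldType) (G : choiceType) (A : G -> nualgType K).

Record dsum := Dsum {
  dsum_fun :> forall p, A p;
  dsum_finite : finite_set [set p | dsum_fun p != 0]
}.

HB.instance Definition _ := gen_eqMixin dsum.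
HB.instance Definition _ := gen_choiceMixin dsum.

Implicit Types a b : dsum.

Lemma dsum_eq a b : (forall p, a p = b p) -> a = b.
Proof.
case: a b => [f ff] [g fg] /= /(@functional_extensionality_dep _ _ f g) e.
by subst g; congr Dsum; exact: Prop_irrelevance.
Qed.

Let finS a (f : forall p, A p) :
  (forall p, a p = 0 -> f p = 0) -> finite_set [set p | f p != 0].
Proof.
move=> e; apply: sub_finite_set (dsum_finite a) => p /=.
by apply: contra => /eqP /e ->.
Qed.

Let fin0 : finite_set [set p | (0 : A p) != 0].
Proof.
apply: sub_finite_set (finite_set0 G) => p /=.
by rewrite eqxx.
Qed.

Let finD a b : finite_set [set p | a p + b p != 0].
Proof.
apply: (@sub_finite_set _ _ ([set p | a p != 0] `|` [set p | b p != 0])%classic).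
  move=> p /= ab0; case: (eqVneq (a p) 0) => [a0|]; last by left.
  by right; rewrite a0 add0r in ab0.
by rewrite finite_setU; split; exact: dsum_finite.
Qed.

Let finN a : finite_set [set p | - a p != 0].
Proof. by apply: (@finS a) => p ->; rewrite oppr0. Qed.

Let finZ c a : finite_set [set p | c *: a p != 0].
Proof. by apply: (@finS a) => p ->; rewrite scaler0. Qed.

Let finM a b : finite_set [set p | a p ** b p != 0].
Proof. by apply: (@finS a) => p ->; exact: (lin0 (nmul_linl _)). Qed.

Let zero := Dsum fin0.
Let add a b := Dsum (finD a b).
Let opp a := Dsum (finN a).
Let scale c a := Dsum (finZ c a).
Let mul a b := Dsum (finM a b).

Let addA : associative add.
Proof. by move=> a b c; apply: dsum_eq => p; exact: addrA. Qed.
Let addC : commutative add.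
Proof. by move=> a b; apply: dsum_eq => p; exact: addrC. Qed.
Let add0 : left_id zero add.
Proof. by move=> a; apply: dsum_eq => p; exact: add0r. Qed.
Let addN : left_inverse zero opp add.
Proof. by move=> a; apply: dsum_eq => p; exact: addNr. Qed.

HB.instance Definition _ := GRing.isZmodule.Build dsum addA addC add0 addN.

Let scaleA c d a : scale c (scale d a) = scale (c * d) a.
Proof. by apply: dsum_eq => p; exact: scalerA. Qed.
Let scale1 : left_id 1 scale.
Proof. by move=> a; apply: dsum_eq => p; exact: scale1r. Qed.
Let scaleDr : right_distributive scale +%R.
Proof. by move=> c a b; apply: dsum_eq => p; exact: scalerDr. Qed.
Let scaleDl a : {morph scale^~ a : c d / c + d}.
Proof. by move=> c d; apply: dsum_eq => p; exact: scalerDl. Qed.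

HB.instance Definition _ := GRing.Zmodule_isLmodule.Build K dsum
  scaleA scale1 scaleDr scaleDl.

Let mulA : associative mul.
Proof. by move=> a b c; apply: dsum_eq => p; exact: nmulA. Qed.
Let mul_linl b : linear (mul^~ b).
Proof. by move=> c x y; apply: dsum_eq => p; exact: nmul_linl. Qed.
Let mul_linr a : linear (mul a).
Proof. by move=> c x y; apply: dsum_eq => p; exact: nmul_linr. Qed.

HB.instance Definition _ := Lmodule_isNonUnitalAlg.Build K dsum
  mulA mul_linl mul_linr.

Definition dproj p (a : dsum) : A p := a p.

Lemma dproj_linear p : linear (dproj p). Proof. by []. Qed.

Definition dinj_fun p (a : A p) : forall q, A q := fun q =>
  if p =P q is ReflectT e then ecast r (A r) e a else 0.

Lemma dinj_fun_id p (a : A p) : dinj_fun a p = a.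
Proof. by rewrite /dinj_fun; case: eqP => // e; rewrite eq_axiomK. Qed.

Lemma dinj_fun_neq p q (a : A p) : p != q -> dinj_fun a q = 0.
Proof. by rewrite /dinj_fun; case: eqP. Qed.

Let dinj_finite p (a : A p) : finite_set [set q | dinj_fun a q != 0].
Proof.
apply: sub_finite_set (finite_set1 p) => q /=.
by apply: contra_neqP => pq; apply: dinj_fun_neq; apply/eqP => /esym.
Qed.

Definition dinj p (a : A p) : dsum := Dsum (dinj_finite a).

Lemma dinj_id p (a : A p) : dproj p (dinj a) = a.
Proof. exact: dinj_fun_id. Qed.

Lemma dinj_neq p q (a : A p) : p != q -> dproj q (dinj a) = 0.
Proof. exact: dinj_fun_neq. Qed.

Lemma dinj_linear p : linear (@dinj p).
Proof.
move=> c x y; apply: dsum_eq => q; rewrite -[RHS]/(c *: dinj x q + dinj y q) /=.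
rewrite /dinj_fun; case: eqP => [e|_]; last by rewrite scaler0 addr0.
by case: _ / e.
Qed.

Lemma dsum_sum (a : dsum) (s : seq G) : uniq s ->
  (forall p, a p != 0 -> p \in s) -> a = \sum_(p <- s) dinj (a p).
Proof.
move=> us sa; apply: dsum_eq => q.
rewrite -[RHS]/(dproj q _).
have pD (I : Type) (r : seq I) (F : I -> dsum) :
    dproj q (\sum_(i <- r) F i) = \sum_(i <- r) dproj q (F i).
  by elim: r => [|i r IHr]; rewrite ?big_nil // !big_cons -IHr.
rewrite pD; case: (boolP (q \in s)) => qs.
  rewrite (bigD1_seq q qs us).
  rewrite -[RHS]/(dproj q (dinj (a q)) +
    \sum_(p <- s | p != q) dproj q (dinj (a p))).
  rewrite dinj_id big1 => [|p pq]; first by rewrite addr0.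
  exact: dinj_neq.
rewrite big_seq big1 => [|p ps]; last first.
  by apply: dinj_neq; apply: contraNneq qs => <-.
by apply/eqP; apply: contraNT qs => /sa.
Qed.

End DirectSum.

(* Functions on G x G with values x p q in M(A_p (x) A_q) as multipliers of
   A_G (x) A_G, acting componentwise (glueP). *)
Section Glue.
Variables (K : fieldType) (G : choiceType) (A : G -> nualgType K).
Let AG := dsum A.
Let AGG : nualgType K := tensor AG AG.

Definition proj2 p q : tensor AG AG -> tensor (A p) (A q) :=
  tmap (dproj p) (dproj q).
Definition inj2 p q : tensor (A p) (A q) -> tensor AG AG :=
  tmap (@dinj K G A p) (@dinj K G A q).

Lemma proj2_linear p q : linear (proj2 p q).
Proof. by apply: tmap_linear; exact: dproj_linear. Qed.
Lemma inj2_linear p q : linear (@inj2 p q).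
Proof. by apply: tmap_linear; exact: dinj_linear. Qed.

Lemma proj2_tens p q a b : proj2 p q (tens a b) = tens (a p) (b q).
Proof. by rewrite /proj2 tmap_tens. Qed.
Lemma inj2_tens p q (a : A p) (b : A q) :
  inj2 (tens a b) = tens (dinj a) (dinj b).
Proof. by rewrite /inj2 tmap_tens //; exact: dinj_linear. Qed.

Lemma proj2_mul p q (s t : AGG) :
  proj2 p q (s ** t) = proj2 p q s ** proj2 p q t :> tensor (A p) (A q).
Proof.
have pl := proj2_linear p q.
elim/tensor_ind: s => [|a b|s s' es es'].
- rewrite (lin0 (@nmul_linl K AGG _)) (lin0 pl).
  by rewrite (lin0 (@nmul_linl K (tensor (A p) (A q)) _)).
- elim/tensor_ind: t => [|a' b'|t t' et et'].
  + rewrite (lin0 (@nmul_linr K AGG _)) (lin0 pl).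
    by rewrite (lin0 (@nmul_linr K (tensor (A p) (A q)) _)).
  + by rewrite tens_mul !proj2_tens tens_mul.
  + by rewrite (linD (@nmul_linr K AGG _)) !(linD pl) et et'
      (linD (@nmul_linr K (tensor (A p) (A q)) _)).
- by rewrite (linD (@nmul_linl K AGG _)) !(linD pl) es es'
    (linD (@nmul_linl K (tensor (A p) (A q)) _)).
Qed.

Lemma proj2_inj2 p q (u : tensor (A p) (A q)) : proj2 p q (inj2 u) = u.
Proof.
have pl := proj2_linear p q; have il := @inj2_linear p q.
elim/tensor_ind: u => [|a b|x y ex ey].
- by rewrite (lin0 il) (lin0 pl).
- by rewrite inj2_tens proj2_tens; congr tens; exact: dinj_id.
- by rewrite (linD il) (linD pl) ex ey.
Qed.

Lemma proj2_inj2_neq p q p' q' (u : tensor (A p) (A q)) :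
  (p, q) != (p', q') -> proj2 p' q' (inj2 u) = 0.
Proof.
move=> ne; have pl := proj2_linear p' q'; have il := @inj2_linear p q.
elim/tensor_ind: u => [|a b|x y ex ey].
- by rewrite (lin0 il) (lin0 pl).
- rewrite inj2_tens proj2_tens; have [b0 b0'] := tens_bilin (A p') (A q').
  move: ne; rewrite xpair_eqE negb_and => /orP[pp|qq].
    by rewrite [dinj a p'](dinj_neq a pp) (lin0 (b0 _)).
  by rewrite [dinj b q'](dinj_neq b qq) (lin0 (b0' _)).
- by rewrite (linD il) (linD pl) ex ey addr0.
Qed.

Let linS (V W : lmodType K) (f : V -> W) (I : Type) (r : seq I) (F : I -> V) :
  linear f -> f (\sum_(i <- r) F i) = \sum_(i <- r) f (F i).
Proof.
move=> lf; elim: r => [|i r IHr]; first by rewrite !big_nil lin0.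
by rewrite !big_cons linD // IHr.
Qed.

Lemma proj2_decomp (t : tensor AG AG) : exists s : seq G,
  forall s', uniq s' -> {subset s <= s'} ->
  t = \sum_(p <- s') \sum_(q <- s') inj2 (proj2 p q t).
Proof.
elim/tensor_ind: t => [|a b|t t' [s es] [s' es']].
- exists [::] => s' _ _; rewrite big1 // => p _; rewrite big1 // => q _.
  by rewrite (lin0 (proj2_linear p q)) (lin0 (@inj2_linear p q)).
- have /finite_seqP [s es] := dsum_finite a.
  have /finite_seqP [s' es'] := dsum_finite b.
  exists (s ++ s') => r ur sub.
  have sa p : a p != 0 -> p \in r.
    move=> ap; apply: sub; rewrite mem_cat.
    have : ([set` s])%classic p by rewrite -es.
    by move=> /= ->.
  have sb p : b p != 0 -> p \in r.
    move=> bp; apply: sub; rewrite mem_cat.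
    have : ([set` s'])%classic p by rewrite -es'.
    by move=> /= ->; rewrite orbT.
  rewrite {1}(dsum_sum ur sa) (linS _ _ ((tens_bilin AG AG).1 b)).
  apply: eq_bigr => p _.
  rewrite {1}(dsum_sum ur sb) (linS _ _ ((tens_bilin AG AG).2 _)).
  by apply: eq_bigr => q _; rewrite proj2_tens inj2_tens.
- exists (s ++ s') => r ur sub.
  rewrite {1}(es r) // => [|p ps]; last by apply: sub; rewrite mem_cat ps.
  rewrite {1}(es' r) // => [|p ps]; last by apply: sub; rewrite mem_cat ps orbT.
  rewrite -big_split; apply: eq_bigr => p _.
  rewrite -big_split; apply: eq_bigr => q _ /=.
  by rewrite (linD (proj2_linear p q)) (linD (@inj2_linear p q)).
Qed.

Lemma proj2_eq (t t' : tensor AG AG) :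
  (forall p q, proj2 p q t = proj2 p q t') -> t = t'.
Proof.
move=> e; have [s es] := proj2_decomp t; have [s' es'] := proj2_decomp t'.
have u := undup_uniq (s ++ s').
rewrite (es _ u) => [|p ps]; last by rewrite mem_undup mem_cat ps.
rewrite (es' _ u) => [|p ps]; last by rewrite mem_undup mem_cat ps orbT.
by apply: eq_bigr => p _; apply: eq_bigr => q _; rewrite e.
Qed.

Lemma glue_ex (f : forall p q, tensor (A p) (A q) -> tensor (A p) (A q)) t :
  (forall p q, linear (f p q)) ->
  exists y, forall p q, proj2 p q y = f p q (proj2 p q t).
Proof.
move=> lf; have [s /(_ (undup s) (undup_uniq s))] := proj2_decomp t.
move=> /(_ (fun p ps => etrans (mem_undup s p) ps)).
move: (undup s) (undup_uniq s) => {}s us et.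
have key (F : forall p q, tensor (A p) (A q)) p q :
    proj2 p q (\sum_(p' <- s) \sum_(q' <- s) inj2 (F p' q')) =
    if (p \in s) && (q \in s) then F p q else 0.
  have pl := proj2_linear p q; rewrite (linS _ _ pl).
  have inner p' : proj2 p q (\sum_(q' <- s) inj2 (F p' q')) =
      \sum_(q' <- s) proj2 p q (inj2 (F p' q')) by exact: linS.
  case: (boolP (p \in s)) => ps /=; last first.
    rewrite big_seq big1 // => p' p's; rewrite inner big1 // => q' _.
    apply: proj2_inj2_neq; rewrite xpair_eqE negb_and; apply/orP; left.
    by apply: contraNneq ps => <-.
  rewrite (bigD1_seq p) //= [X in _ + X]big1 ?addr0 => [|p' pp]; last first.
    rewrite inner big1 // => q' _; apply: proj2_inj2_neq.
    by rewrite xpair_eqE negb_and pp.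
  rewrite inner; case: (boolP (q \in s)) => qs; last first.
    rewrite big_seq big1 // => q' q's; apply: proj2_inj2_neq.
    rewrite xpair_eqE negb_and; apply/orP; right.
    by apply: contraNneq qs => <-.
  rewrite (bigD1_seq q) //= proj2_inj2 big1 ?addr0 // => q' qq.
  by apply: proj2_inj2_neq; rewrite xpair_eqE negb_and qq orbT.
exists (\sum_(p <- s) \sum_(q <- s) inj2 (f p q (proj2 p q t))) => p q.
rewrite key; case: ifP => // pq.
by rewrite {1}et key pq (lin0 (lf p q)).
Qed.

Variable x : forall p q, multiplier (tensor (A p) (A q)).

Let lL p q : linear (multL (x p q)). Proof. by case: (multP (x p q)). Qed.
Let lR p q : linear (multR (x p q)). Proof. by case: (multP (x p q)). Qed.

Definition glueL (t : tensor AG AG) : tensor AG AG := sval (cid (glue_ex t lL)).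
Definition glueR (t : tensor AG AG) : tensor AG AG := sval (cid (glue_ex t lR)).

Lemma proj2_glueL p q t : proj2 p q (glueL t) = multL (x p q) (proj2 p q t).
Proof. by rewrite /glueL; case: cid => y /= ->. Qed.
Lemma proj2_glueR p q t : proj2 p q (glueR t) = multR (x p q) (proj2 p q t).
Proof. by rewrite /glueR; case: cid => y /= ->. Qed.

Let glue_is_mult : @is_multiplier K AGG (glueL, glueR).
Proof.
split=> [c s t|c s t|s t|s t|s t] /=; apply: proj2_eq => p q;
  have [/= Lx Rx LMx RMx Mx] := multP (x p q).
- by rewrite proj2_glueL !(proj2_linear p q) Lx !proj2_glueL.
- by rewrite proj2_glueR !(proj2_linear p q) Rx !proj2_glueR.
- by rewrite proj2_glueL !proj2_mul LMx proj2_glueL.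
- by rewrite proj2_glueR !proj2_mul RMx proj2_glueR.
- by rewrite !proj2_mul proj2_glueL proj2_glueR Mx.
Qed.

Definition glue : multiplier (tensor AG AG) := mk_mult glue_is_mult.

Lemma glueP p q : intertwines (proj2 p q) glue (x p q).
Proof. by move=> t; split; [exact: proj2_glueL | exact: proj2_glueR]. Qed.

End Glue.

Section Comultiplication.
Variables (K : fieldType) (P Q S : nualgType K).
Variable D : S -> multiplier (tensor P Q).

Definition cov_right : Prop := forall (a : S) (b : Q),
  exists t : tensor P Q, emb t = D a ** mtens 1%M (emb b).

Definition cov_left : Prop := forall (a : P) (b : S),
  exists t : tensor P Q, emb t = mtens (emb a) 1%M ** D b.

Definition can_right_bij : Prop := exists T : tensor S Q -> tensor P Q,
  [/\ linear T, bijective T &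
      forall a b, emb (T (tens a b)) = D a ** mtens 1%M (emb b)].

Definition can_left_bij : Prop := exists T : tensor P S -> tensor P Q,
  [/\ linear T, bijective T &
      forall a b, emb (T (tens a b)) = mtens (emb a) 1%M ** D b].

End Comultiplication.

(* With S = A_pq, T = A_qr and V = A_pqr: the elements s of A_pq (x) A_r and t of
   A_p (x) A_qr are D_{pq,r}(b)(1 (x) c) and (a (x) 1) D_{p,qr}(b), and the two
   sides are compared along (A_p (x) A_q) (x) A_r -> A_p (x) (A_q (x) A_r). *)
Definition coassociative (K : fieldType) (P Q R S T V : nualgType K)
    (D_pq : S -> multiplier (tensor P Q)) (D_pq_r : V -> multiplier (tensor S R))
    (D_qr : T -> multiplier (tensor Q R)) (D_p_qr : V -> multiplier (tensor P T)) :
    Prop :=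
  forall (a : P) (b : V) (c : R) (s : tensor S R) (t : tensor P T),
  emb s = D_pq_r b ** mtens 1%M (emb c) ->
  emb t = mtens (emb a) 1%M ** D_p_qr b ->
  intertwines (@tassoc K P Q R)
    (mtens (mtens (emb a) 1%M) 1%M ** tensor_hom D_pq (@emb K R) s)
    (tensor_hom (@emb K P) D_qr t ** mtens 1%M (mtens 1%M (emb c))).

Section GroupCoalgebra.
Variables (K : fieldType) (G : groupType) (A : G -> nualgType K).
Variable D : forall p q : G, A (p * q)%g -> multiplier (tensor (A p) (A q)).

Definition comult_assoc p q r (b : A (p * q * r)%g) :
    multiplier (tensor (A p) (A (q * r)%g)) :=
  D (ecast g (A g) (esym (mulgA p q r)) b).

Record multiplier_hopf_Gcoalgebra : Prop := MultiplierHopfGcoalgebra {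
  Gcoalg_nondegenerate : forall p, nondegenerate (A p);
  Gcoalg_hom : forall p q, is_hom (@D p q);
  Gcoalg_cov_right : forall p q, cov_right (@D p q);
  Gcoalg_cov_left : forall p q, cov_left (@D p q);
  Gcoalg_coassoc : forall p q r,
    coassociative (@D p q) (@D (p * q)%g r) (@D q r) (@comult_assoc p q r);
  Gcoalg_can_right : forall p q, can_right_bij (@D p q);
  Gcoalg_can_left : forall p q, can_left_bij (@D p q)
}.

Definition comult_G (a : dsum A) : multiplier (tensor (dsum A) (dsum A)) :=
  glue (fun p q => D (a (p * q)%g)).

End GroupCoalgebra.

Record multiplier_hopf_algebra (K : fieldType) (A : nualgType K)
    (D : A -> multiplier (tensor A A)) : Prop := MultiplierHopfAlgebra {
  hopf_nondegenerate : nondegenerate A;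
  hopf_hom : is_hom D;
  hopf_cov_right : cov_right D;
  hopf_cov_left : cov_left D;
  hopf_coassoc : coassociative D D D D;
  hopf_can_right : can_right_bij D;
  hopf_can_left : can_left_bij D
}.

(* K(G) *)
Definition fin_functions (K : fieldType) (G : choiceType) : nualgType K :=
  dsum (fun _ : G => K^o : nualgType K).

(* A function F on G x G is the multiplier of K(G) (x) K(G) acting at (p, q) as
   the scalar F(p, q). *)
Definition comult_fun (K : fieldType) (G : groupType) (f : fin_functions K G) :
    multiplier (tensor (fin_functions K G) (fin_functions K G)) :=
  glue (fun p q => (f (p * q)%g : K) *: 1%M).

(* Main.v *)
(** Multipliers of A_G (x) A_G are determined by their components in the
    M(A_p (x) A_q), so each axiom for Delta_G reduces to the same axiom for the
    Delta_{p,q}; the canonical maps of A_G are those of the family with the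
    components permuted by (p, q) |-> (pq, q) and (p, q) |-> (p, pq).
    That Delta_G is a nondegenerate homomorphism (hence extends to multipliers)
    needs A_G = A_G A_G.  This holds in every multiplier Hopf algebra: with T
    and T' the canonical maps and m the product, coassociativity gives
    (I (x) m T^-1)(T'(a (x) b) (x) c) = ab (x) c, and applying to the first leg
    a functional that is 1 at ab writes c as a sum of products.
    Finally gamma(f) multiplies the component at p by f(p), and both extensions
    send f to the multiplier that is the scalar f(pq) on the component (p, q). *)

Require Import Defs.
From mathcomp Require Import all_boot all_order all_algebra.
From mathcomp Require Import boolp classical_sets cardinality reals.
From mathcomp Require Import complex.

Set Implicit Arguments.
Unset Strict Implicit.
Unset Printing Implicit Defensive.
Local Open Scope ring_scope.
Local Open Scope complex_scope.

Import GRing.Theory.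
(* MathComp's [nondegenerate] on sesquilinear forms shadows the one of Defs. *)
Local Notation nondegenerate := Defs.nondegenerate.

(** * Linear functionals and slices of tensors over a field *)

Section LinearFunctionals.
Variable K : fieldType.
Implicit Types U V : lmodType K.

(** Zorn's lemma gives a subspace [W] maximal among those missing [v]. It is a complement of the
    line through [v], and [f] reads off the coefficient of [v]. *)
Lemma exists_functional V (v : V) : v != 0 ->
  exists f : V -> K^o, linear f /\ f v = 1.
Proof.
(* [closed] does not ask for [0], so the empty set lies in [P] and the empty chain has its union in
   [P]. Maximality gives [W 0] afterwards. *)
move=> v0; pose closed (W : set V) := forall c x y, W x -> W y -> W (c *: x + y).
pose P : set (set V) := fun W => closed W /\ ~ W v.
have [F FP Ftot|W [[Wcl Wv] Wmax]] := @Zorn_bigcup V P.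
  split=> [c x y [X FX Xx] [Y FY Yy]|[X FX Xv]]; last by case: (FP _ FX).
  have [XY|YX] := Ftot _ _ FX FY.
  - by exists Y => //; apply: (FP _ FY).1 => //; exact: XY.
  - by exists X => //; apply: (FP _ FX).1 => //; exact: YX.
have W0 : W 0.
  apply: contrapT => nW0; apply: (Wmax (fun x => W x \/ x = 0)).
    by split=> [x Wx|e]; [left | apply: nW0; apply: e; right].
  split=> [c x y|[//|ev]]; last by rewrite ev eqxx in v0.
  move=> [Wx|->] [Wy|->]; rewrite ?scaler0 ?addr0 ?add0r; [|..|by right].
  - by left; exact: Wcl.
  (* As [0] is not yet known to be in [W], [c *: x] is written as [(c - 1) *: x + x]. *)
  - left; rewrite -[c](subrK 1) scalerDl scale1r.
    exact: Wcl.
  - by left.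
have WZ c x : W x -> W (c *: x) by move=> Wx; rewrite -[_ *: _]addr0; exact: Wcl.
have WD x y : W x -> W y -> W (x + y).
  by move=> Wx Wy; rewrite -[x]scale1r; exact: Wcl.
have dec u : exists c : K, W (u - c *: v).
  apply: contrapT => nc; have nWu : ~ W u.
    by move=> Wu; apply: nc; exists 0; rewrite scale0r subr0.
  (* If no [c] works, the sum of [W] and the line through [u] is strictly larger and still misses
     [v]: from [v - d *: u] in [W], dividing by [d] would give the coefficient [d^-1] for [u]. *)
  apply: (Wmax (fun x => exists d, W (x - d *: u))).
    split=> [x Wx|e]; first by exists 0; rewrite scale0r subr0.
    by apply: nWu; apply: e; exists 1; rewrite scale1r subrr.
  split=> [c x y [d Wd] [d' Wd']|[d Wd]].
    exists (c * d + d'); have := Wcl c _ _ Wd Wd'.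
    by rewrite scalerBr scalerA scalerDl opprD addrACA.
  have [d0|d0] := eqVneq d 0; first by rewrite d0 scale0r subr0 in Wd.
  apply: nc; exists d^-1; have := WZ (- d^-1) _ Wd.
  by rewrite scalerBr scalerA mulNr mulVf // scaleN1r opprK addrC scaleNr.
have uniq c : W (c *: v) -> c = 0.
  move=> Wc; apply/eqP; apply: contrapT => /negP c0; apply: Wv.
  by rewrite -[v]scale1r -(mulVf c0) -scalerA; exact: WZ.
pose f u : K^o := sval (cid (dec u)).
have fP u : W (u - f u *: v) by rewrite /f; case: cid.
have f_eq u c : W (u - c *: v) -> f u = c.
  move=> Wc; apply/eqP; rewrite -subr_eq0; apply/eqP/uniq.
  have := Wcl (-1) _ _ (fP u) Wc.
  by rewrite scaleN1r opprB addrA subrK scalerBl.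
exists f; split=> [c x y|]; apply: f_eq; last by rewrite scale1r subrr.
have := Wcl c _ _ (fP x) (fP y).
by rewrite scalerBr scalerA scalerDl opprD addrACA.
Qed.

(** The map w (x) I followed by K (x) V = V; [slicer] evaluates the second leg instead. *)
Definition slicel U V (w : U -> K^o) : tensor U V -> V :=
  tlift (fun u v => (w u : K) *: v).
Definition slicer U V (w : V -> K^o) : tensor U V -> U :=
  tlift (fun u v => (w v : K) *: u).

Lemma slicel_bilin U V (w : U -> K^o) : linear w ->
  bilin (fun (u : U) (v : V) => (w u : K) *: v).
Proof.
move=> lw; apply: bilin_intro => *.
- by rewrite (linD lw) scalerDl.
- by rewrite scalerDr.
- by rewrite (linZ lw) scalerA.
- by rewrite !scalerA mulrC.
Qed.

Lemma slicer_bilin U V (w : V -> K^o) : linear w ->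
  bilin (fun (u : U) (v : V) => (w v : K) *: u).
Proof. by move=> lw; have [? ?] := slicel_bilin U lw; split. Qed.

Lemma slicel_linear U V (w : U -> K^o) : linear w -> linear (@slicel U V w).
Proof. by move=> lw; apply/tlift_linear/slicel_bilin. Qed.
Lemma slicer_linear U V (w : V -> K^o) : linear w -> linear (@slicer U V w).
Proof. by move=> lw; apply/tlift_linear/slicer_bilin. Qed.

Lemma slicel_tens U V (w : U -> K^o) u (v : V) : linear w ->
  slicel w (tens u v) = (w u : K) *: v.
Proof. by move=> lw; apply/tlift_tens/slicel_bilin. Qed.
Lemma slicer_tens U V (w : V -> K^o) (u : U) v : linear w ->
  slicer w (tens u v) = (w v : K) *: u.
Proof. by move=> lw; apply/tlift_tens/slicer_bilin. Qed.

Lemma tensor_sum U V (t : tensor U V) :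
  exists s : seq (U * V), t = \sum_(z <- s) tens z.1 z.2.
Proof.
elim/tensor_ind: t => [|u v|x y [s ->] [s' ->]].
- by exists [::]; rewrite big_nil.
- by exists [:: (u, v)]; rewrite big_seq1.
- by exists (s ++ s'); rewrite big_cat.
Qed.

Lemma lin_sum U V (f : U -> V) (I : Type) (r : seq I) (F : I -> U) :
  linear f -> f (\sum_(i <- r) F i) = \sum_(i <- r) f (F i).
Proof.
move=> lf; elim: r => [|i r IHr]; first by rewrite !big_nil lin0.
by rewrite !big_cons linD // IHr.
Qed.

(* Gaussian elimination: a slice that vanishes at [t] but not at the leading
   vector expresses [t] with one elementary tensor less. *)
Lemma slicel_eq0 U V (t : tensor U V) :
  (forall w : U -> K^o, linear w -> slicel w t = 0) -> t = 0.
Proof.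
have [s ->] := tensor_sum t; have [n] := ubnP (size s).
elim: n s => // n IHn [|[u v] s] /= ns h; first by rewrite big_nil.
have [Dl Dr Zl Zr] := bilinP (tens_bilin U V).
move: h; rewrite !big_cons /=; have [-> h|u0 h] := eqVneq u 0.
  rewrite (lin0 ((tens_bilin _ _).1 v)) add0r; apply: IHn => // w lw.
  have := h w lw; rewrite (linD (slicel_linear lw)) slicel_tens //.
  by rewrite (lin0 lw) scale0r add0r.
have [w [lw wu]] := exists_functional u0.
have ev : v = - \sum_(z <- s) (w z.1 : K) *: z.2.
  have /eqP := h w lw; rewrite (linD (slicel_linear lw)) slicel_tens // wu.
  rewrite scale1r addr_eq0 => /eqP ->; congr (- _).
  rewrite (lin_sum _ _ (slicel_linear lw)).
  by apply: eq_bigr => z _; rewrite slicel_tens.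
pose s' := [seq (z.1 - (w z.1 : K) *: u, z.2) | z <- s].
have e : tens u v + \sum_(z <- s) tens z.1 z.2 = \sum_(z <- s') tens z.1 z.2.
  rewrite {1}ev -scaleN1r Zr scaleN1r (lin_sum _ _ ((tens_bilin _ _).2 u)).
  rewrite addrC -sumrB big_map; apply: eq_bigr => z _ /=.
  by rewrite -scaleNr Dl Zl Zr scaleNr.
rewrite e; apply: IHn => [|w' lw']; first by rewrite size_map.
by rewrite -e; exact: h.
Qed.

Definition tswap U V : tensor U V -> tensor V U := tlift (fun u v => tens v u).

Lemma tswap_bilin U V : bilin (fun (u : U) (v : V) => tens v u).
Proof. by have [? ?] := tens_bilin V U; split. Qed.

Lemma slicer_eq0 U V (t : tensor U V) :
  (forall w : V -> K^o, linear w -> slicer w t = 0) -> t = 0.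
Proof.
have sl U' V' : linear (@tswap U' V') by exact/tlift_linear/tswap_bilin.
have st U' V' (u : U') (v : V') : tswap (tens u v) = tens v u.
  exact/tlift_tens/tswap_bilin.
move=> h; suff e : tswap t = 0.
  have <- : tswap (tswap t) = t; last by rewrite e (lin0 (@sl _ _)).
  apply: (@tensor_eqfun _ _ _ _ (fun t => tswap (tswap t)) id) => // [c x y|u v].
    by rewrite !sl.
  by rewrite !st.
apply: slicel_eq0 => w lw; rewrite -(h w lw).
apply: (@tensor_eqfun _ _ _ _ (fun t => slicel w (tswap t)) (slicer w)) => //.
- by move=> c x y; rewrite sl (slicel_linear lw).
- exact: slicer_linear.
- by move=> u v; rewrite st slicel_tens // slicer_tens.
Qed.

(** Slices reduce the claim to one leg at a time, since a map on one leg commutes with slicing the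
    other. It serves both for nondegeneracy of tensor products and for comparing tensors
    componentwise. *)
Lemma tmap_jointly_injective U V (I J : Type) (U' : I -> lmodType K)
    (V' : J -> lmodType K) (f : forall i, U -> U' i) (g : forall j, V -> V' j)
    (t : tensor U V) :
  (forall i, linear (f i)) -> (forall j, linear (g j)) ->
  (forall u, (forall i, f i u = 0) -> u = 0) ->
  (forall v, (forall j, g j v = 0) -> v = 0) ->
  (forall i j, tmap (f i) (g j) t = 0) -> t = 0.
Proof.
move=> lf lg fi gi h.
have comp (W X Y : lmodType K) (k : W -> X) (l : X -> Y) : linear k -> linear l ->
  linear (fun x => l (k x)) by move=> lk ll c x y; rewrite lk ll.
(* Each [g j] sends this slice to the slice of [tmap (f i) (g j) t] by [w], which is zero. *)
have {}h i (w : U' i -> K^o) : linear w -> slicel (fun u => w (f i u)) t = 0.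
  move=> lw; have lwf := comp _ _ _ _ _ (lf i) lw; apply: gi => j.
  suff -> : g j (slicel (fun u => w (f i u)) t) = slicel w (tmap (f i) (g j) t).
    by rewrite h (lin0 (slicel_linear lw)).
  move: (t); apply: tensor_eqfun => [||u v].
  - by apply: comp => //; exact: slicel_linear.
  - by apply: comp; [exact: tmap_linear | exact: slicel_linear].
  - by rewrite tmap_tens // !slicel_tens // (linZ (lg j)).
apply: slicer_eq0 => w lw; apply: fi => i.
have lid : linear (@idfun V) by [].
(* Its slices by [w'] are the slices of [t] by [w'] after [f i], which vanish by [h]. *)
have e : tmap (f i) (@idfun V) t = 0.
  apply: slicel_eq0 => w' lw'; have lwf := comp _ _ _ _ _ (lf i) lw'.
  rewrite -(h i w' lw'); move: (t); apply: tensor_eqfun => [||u v].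
  - by apply: comp; [exact: tmap_linear | exact: slicel_linear].
  - exact: slicel_linear.
  - by rewrite tmap_tens // !slicel_tens.
suff -> : f i (slicer w t) = slicer w (tmap (f i) (@idfun V) t).
  by rewrite e (lin0 (slicer_linear lw)).
move: (t); apply: tensor_eqfun => [||u v].
- by apply: comp => //; exact: slicer_linear.
- by apply: comp; [exact: tmap_linear | exact: slicer_linear].
- by rewrite tmap_tens // !slicer_tens // (linZ (lf i)).
Qed.

End LinearFunctionals.

Lemma linear_comp (K : fieldType) (U V W : lmodType K) (f : U -> V) (g : V -> W) :
  linear f -> linear g -> linear (fun u => g (f u)).
Proof. by move=> lf lg c x y; rewrite lf lg. Qed.

Lemma scale_linear (K : fieldType) (V : lmodType K) (d : K) :
  linear (fun x : V => d *: x).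
Proof. by move=> c x y; rewrite scalerDr !scalerA mulrC. Qed.

(** * Spans and functions determined on spanning families *)

Section Spanning.
Variables (K : fieldType) (V : lmodType K) (I : Type) (g : I -> V).

Definition in_span (v : V) : Prop :=
  exists s : seq (K * I), v = \sum_(z <- s) z.1 *: g z.2.

Lemma in_span0 : in_span 0.
Proof. by exists [::]; rewrite big_nil. Qed.

Lemma in_spanD u v : in_span u -> in_span v -> in_span (u + v).
Proof. by move=> [s ->] [s' ->]; exists (s ++ s'); rewrite big_cat. Qed.

Lemma in_spanZ c v : in_span v -> in_span (c *: v).
Proof.
move=> [s ->]; exists [seq (c * z.1, z.2) | z <- s].
by rewrite big_map scaler_sumr; apply: eq_bigr => z _; rewrite scalerA.
Qed.

Lemma in_span_gen i : in_span (g i).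
Proof. by exists [:: (1, i)]; rewrite big_seq1 scale1r. Qed.

Lemma spanning_ind (P : V -> Prop) : spanning g -> P 0 ->
  (forall c i v, P v -> P (c *: g i + v)) -> forall v, P v.
Proof.
move=> sg P0 PD v; have [s ->] := sg v; elim: s => [|z s IHs].
  by rewrite big_nil.
by rewrite big_cons; exact: PD.
Qed.

Lemma spanning_eqfun (W : lmodType K) (f h : V -> W) : linear f -> linear h ->
  spanning g -> (forall i, f (g i) = h (g i)) -> f =1 h.
Proof.
move=> lf lh sg e.
apply: (spanning_ind (P := fun v => f v = h v) sg) => [|c i v ev].
  by rewrite !lin0.
by rewrite lf lh e ev.
Qed.

End Spanning.

(** * Multipliers of nondegenerate algebras and of tensor products *)

Section MultiplierTheory.
Variable K : fieldType.
Implicit Types A B : nualgType K.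

Lemma multL_linear A (x : multiplier A) : linear (multL x).
Proof. by case: (multP x). Qed.
Lemma multR_linear A (x : multiplier A) : linear (multR x).
Proof. by case: (multP x). Qed.
Lemma multLM A (x : multiplier A) a b : multL x (a ** b) = multL x a ** b.
Proof. by case: (multP x) => _ _ h _ _; exact: h. Qed.
Lemma multRM A (x : multiplier A) a b : multR x (a ** b) = a ** multR x b.
Proof. by case: (multP x) => _ _ _ h _; exact: h. Qed.
Lemma multRL A (x : multiplier A) a b : multR x a ** b = a ** multL x b.
Proof. by case: (multP x) => _ _ _ _ h; exact: h. Qed.

Lemma nmulBl A (a b c : A) : (a - b) ** c = a ** c - b ** c.
Proof. by rewrite -scaleN1r addrC nmul_linl scaleN1r addrC. Qed.
Lemma nmulBr A (a b c : A) : c ** (a - b) = c ** a - c ** b.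
Proof. by rewrite -scaleN1r addrC nmul_linr scaleN1r addrC. Qed.

Lemma nondegenerate_eql A (a a' : A) : nondegenerate A ->
  (forall b, b ** a = b ** a') -> a = a'.
Proof.
move=> [nA _] e; apply/subr0_eq/nA => b.
by rewrite nmulBr e subrr.
Qed.

Lemma nondegenerate_eqr A (a a' : A) : nondegenerate A ->
  (forall b, a ** b = a' ** b) -> a = a'.
Proof.
move=> [_ nA] e; apply/subr0_eq/nA => b.
by rewrite nmulBl e subrr.
Qed.

(** The left action determines the right one: [multR x a ** b = a ** multL x b] for all [b], and
    nondegeneracy cancels [b]. *)
Lemma mult_eqL A (x y : multiplier A) : nondegenerate A ->
  multL x =1 multL y -> x = y.
Proof.
move=> nA e; apply: mult_eq => // a; apply: (nondegenerate_eqr nA) => b.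
by rewrite !multRL e.
Qed.

Lemma emb_inj A : nondegenerate A -> injective (@emb K A).
Proof.
move=> nA a b e; apply: (nondegenerate_eqr nA) => c.
by rewrite -[LHS]/(multL (emb a) c) e.
Qed.

Lemma emb_hom A : is_hom (@emb K A).
Proof.
split=> [c a b|a b].
  by apply: mult_eq => d; rewrite (multLP, multRP) /=;
    [exact: nmul_linl | exact: nmul_linr].
by rewrite mult_emb.
Qed.

Lemma mul1M A (x : multiplier A) : 1%M ** x = x.
Proof. exact: mult_eq. Qed.
Lemma mulM1 A (x : multiplier A) : x ** 1%M = x.
Proof. exact: mult_eq. Qed.

Lemma tens_nmul A B (a : A) (b : B) (t : tensor A B) :
  tens a b ** t = tmap (nmul a) (nmul b) t :> tensor A B.
Proof.
move: t; apply: tensor_eqfun => [||u v]; first exact: nmul_linr.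
  by apply: tmap_linear; exact: nmul_linr.
by rewrite tens_mul tmap_tens //; exact: nmul_linr.
Qed.

Lemma nmul_tens A B (a : A) (b : B) (t : tensor A B) :
  t ** tens a b = tmap (nmul^~ a) (nmul^~ b) t :> tensor A B.
Proof.
move: t; apply: tensor_eqfun => [||u v]; first exact: nmul_linl.
  by apply: tmap_linear; exact: nmul_linl.
by rewrite tens_mul tmap_tens //; exact: nmul_linl.
Qed.

(** Multiplication by [tens a b] is a [tmap] of multiplications, and nondegeneracy of a factor says
    that its multiplications are jointly injective. *)
Lemma tensor_nondegenerate A B :
  nondegenerate A -> nondegenerate B -> nondegenerate (tensor A B).
Proof.
move=> [lA rA] [lB rB]; split=> t h.
  apply: (tmap_jointly_injective (f := @nmul K A) (g := @nmul K B) (t := t)) => //.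
  - exact: nmul_linr.
  - exact: nmul_linr.
  - by move=> a b; rewrite -tens_nmul.
apply: (tmap_jointly_injective (f := fun a => nmul^~ a)
          (g := fun b => nmul^~ b) (t := t)) => //.
- exact: nmul_linl.
- exact: nmul_linl.
- by move=> a b; rewrite -nmul_tens.
Qed.

Lemma multL_mtens A B (x : multiplier A) (y : multiplier B) a b :
  multL (mtens x y) (tens a b) = tens (multL x a) (multL y b).
Proof. by apply: tmap_tens; exact: multL_linear. Qed.
Lemma multR_mtens A B (x : multiplier A) (y : multiplier B) a b :
  multR (mtens x y) (tens a b) = tens (multR x a) (multR y b).
Proof. by apply: tmap_tens; exact: multR_linear. Qed.

Lemma mult_tensor_eq A B (x y : multiplier (tensor A B)) :
  (forall a b, multL x (tens a b) = multL y (tens a b)) ->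
  (forall a b, multR x (tens a b) = multR y (tens a b)) -> x = y.
Proof.
by move=> eL eR; apply: mult_eq; apply: tensor_eqfun => //;
  (exact: multL_linear || exact: multR_linear).
Qed.

Lemma mtens_mul A B (x x' : multiplier A) (y y' : multiplier B) :
  mtens x y ** mtens x' y' = mtens (x ** x') (y ** y').
Proof.
apply: mult_tensor_eq => a b.
  by rewrite -[LHS]/(multL (mtens x y) (multL (mtens x' y') _)) !multL_mtens.
by rewrite -[LHS]/(multR (mtens x' y') (multR (mtens x y) _)) !multR_mtens.
Qed.

Lemma mtens_emb A B (a : A) (b : B) : mtens (emb a) (emb b) = emb (tens a b).
Proof.
apply: mult_tensor_eq => a' b'; rewrite ?multL_mtens ?multR_mtens;
  exact/esym/tens_mul.
Qed.

Lemma mtens_bilin A B : bilin (@mtens K A B).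
Proof.
split=> [y|x] c u v; apply: mult_tensor_eq => a b;
  rewrite ?multLP ?multRP ?multL_mtens ?multR_mtens ?multLP ?multRP;
  by rewrite ((tens_bilin _ _).1, (tens_bilin _ _).2).
Qed.

Section TensorHom.
Variables (A B A' B' : nualgType K).
Variables (f : A -> multiplier A') (g : B -> multiplier B').
Hypotheses (lf : linear f) (lg : linear g).

Lemma tensor_hom_bilin : bilin (fun a b => mtens (f a) (g b)).
Proof.
split=> [b|a] c x y; rewrite (lf, lg).
  exact: (mtens_bilin _ _).1.
exact: (mtens_bilin _ _).2.
Qed.

Lemma tensor_hom_linear : linear (tensor_hom f g).
Proof. exact/tlift_linear/tensor_hom_bilin. Qed.

Lemma tensor_hom_tens a b : tensor_hom f g (tens a b) = mtens (f a) (g b).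
Proof. exact/tlift_tens/tensor_hom_bilin. Qed.

End TensorHom.

Lemma tensor_hom_is_hom A B A' B'
    (f : A -> multiplier A') (g : B -> multiplier B') :
  is_hom f -> is_hom g -> is_hom (tensor_hom f g : tensor A B -> _).
Proof.
move=> [lf fM] [lg gM]; have lfg := tensor_hom_linear lf lg.
split=> // s t; move: s; apply: tensor_eqfun => [||a b].
- by apply: linear_comp => //; exact: nmul_linl.
- exact: (linear_comp lfg (nmul_linl (tensor_hom f g t))).
move: t; apply: tensor_eqfun => [||a' b'].
- by apply: linear_comp => //; exact: nmul_linr.
- exact: (linear_comp lfg (nmul_linr (tensor_hom f g (tens a b)))).
by rewrite tens_mul !tensor_hom_tens // mtens_mul fM gM.
Qed.

End MultiplierTheory.

(** * Multipliers related by a map of algebras *)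

Section Intertwining.
Variable K : fieldType.
Implicit Types A B C D : nualgType K.

Lemma intertwines_mul A B (h : A -> B) x x' y y' :
  intertwines h x y -> intertwines h x' y' -> intertwines h (x ** x') (y ** y').
Proof.
move=> i i' a; split => /=; first by rewrite (i _).1 (i' _).1.
by rewrite (i' _).2 (i _).2.
Qed.

Lemma intertwines_one A B (h : A -> B) : intertwines h 1%M 1%M.
Proof. by []. Qed.

Lemma intertwines_linear A B (h : A -> B) c x x' y y' : linear h ->
  intertwines h x y -> intertwines h x' y' ->
  intertwines h (c *: x + x') (c *: y + y').
Proof.
by move=> lh i i' a; rewrite multLP multRP !lh (i _).1 (i _).2 (i' _).1 (i' _).2.
Qed.

Lemma intertwines_emb A B (h : A -> B) a :
  (forall a b, h (a ** b) = h a ** h b) -> intertwines h (emb a) (emb (h a)).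
Proof. by move=> hM b; split => /=; rewrite hM. Qed.

(** Carries an identity of multipliers along a surjective [h]; it is applied to the projections onto
    components and to the associator. *)
Lemma intertwines_fun A B (h : A -> B) x y y' : (forall b, exists a, h a = b) ->
  intertwines h x y -> intertwines h x y' -> y = y'.
Proof.
move=> sh i i'; apply: mult_eq => b; have [a <-] := sh b.
  by rewrite -(i a).1 -(i' a).1.
by rewrite -(i a).2 -(i' a).2.
Qed.

Lemma intertwines_mtens A B A' B' (h : A -> A') (k : B -> B') x y x' y' :
  linear h -> linear k -> intertwines h x y -> intertwines k x' y' ->
  intertwines (tmap h k : tensor A B -> tensor A' B') (mtens x x') (mtens y y').
Proof.
move=> lh lk i i' t; have lhk := tmap_linear lh lk.
split; move: t; apply: tensor_eqfun => [||a b].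
- by apply: linear_comp => //; exact: multL_linear.
- by apply: linear_comp => //; exact: multL_linear.
- by rewrite !tmap_tens // !multL_mtens tmap_tens // (i _).1 (i' _).1.
- by apply: linear_comp => //; exact: multR_linear.
- by apply: linear_comp => //; exact: multR_linear.
- by rewrite !tmap_tens // !multR_mtens tmap_tens // (i _).2 (i' _).2.
Qed.

(** Naturality of [tensor_hom], by induction on [s]. It compares the two sides of coassociativity
    for A_G with those for the components. *)
Lemma intertwines_tensor_hom A B A' B' C D C' D'
    (f : A -> multiplier A') (g : B -> multiplier B')
    (f' : C -> multiplier C') (g' : D -> multiplier D')
    (u : A -> C) (v : B -> D) (h : A' -> C') (k : B' -> D') (s : tensor A B) :
  linear f -> linear g -> linear f' -> linear g' ->
  linear u -> linear v -> linear h -> linear k ->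
  (forall a, intertwines h (f a) (f' (u a))) ->
  (forall b, intertwines k (g b) (g' (v b))) ->
  intertwines (tmap h k) (tensor_hom f g s) (tensor_hom f' g' (tmap u v s)).
Proof.
move=> lf lg lf' lg' lu lv lh lk ih ik.
have lhk := tmap_linear lh lk; have luv := tmap_linear lu lv.
have lfg := tensor_hom_linear lf lg; have lfg' := tensor_hom_linear lf' lg'.
elim/tensor_ind: s => [|a b|s s' is_ is'].
- rewrite (lin0 luv) (lin0 lfg) (lin0 lfg') => t.
  by split; rewrite (lin0 lhk).
- rewrite tmap_tens // !tensor_hom_tens //.
  exact: intertwines_mtens.
- rewrite (linD luv) (linD lfg) (linD lfg').
  by rewrite -[tensor_hom f g s]scale1r -[tensor_hom f' g' _]scale1r;
    exact: intertwines_linear.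
Qed.

End Intertwining.

(** * Extension of nondegenerate homomorphisms to multiplier algebras *)

(* The extension [F] is pinned down by [f(a) (F(x) b) = f(a x) b] and
   [(b F(x)) f(a) = b f(x a)]. *)
Section ExtensionExistence.
Variables (K : fieldType) (A B : nualgType K) (f : A -> multiplier B).
Hypotheses (nB : nondegenerate B) (nf : nondegenerate_hom f).

Let lf : linear f. Proof. by case: nf => -[]. Qed.

Let fML a a' b : multL (f (a ** a')) b = multL (f a) (multL (f a') b).
Proof. by case: nf => -[_ ->]. Qed.

Let fMR a a' b : multR (f (a ** a')) b = multR (f a') (multR (f a) b).
Proof. by case: nf => -[_ ->]. Qed.

(** Since (b f(a)) y = b (f(a) y) and the elements b f(a) span [B], the hypothesis gives b y = b y'
    for every b. *)
Lemma nondegenerate_hom_eqL y y' :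
  (forall a, multL (f a) y = multL (f a) y') -> y = y'.
Proof.
case: nf => _ _ sR e; apply: (nondegenerate_eql nB) => b; move: b.
apply: (spanning_eqfun _ _ sR) => [||[a b]]; [exact: nmul_linl..|].
by rewrite !multRL e.
Qed.

Lemma nondegenerate_hom_eqR y y' :
  (forall a, multR (f a) y = multR (f a) y') -> y = y'.
Proof.
case: nf => _ sL _ e; apply: (nondegenerate_eqr nB) => b; move: b.
apply: (spanning_eqfun _ _ sL) => [||[a b]]; [exact: nmul_linr..|].
by rewrite -!multRL e.
Qed.

(** For b = f(a1) b1 take y = f(x a1) b1, then extend along a decomposition of [b]. The condition
    has only one solution by [nondegenerate_hom_eqL], so independence of the decomposition is
    automatic. *)
Lemma extL_ex x b : exists y, forall a,
  multL (f a) y = multL (f (multR x a)) b.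
Proof.
case: nf => _ sL _; move: b.
apply: (spanning_ind sL) => [|c [a1 b1] v [y ey]].
  by exists 0 => a; rewrite !(lin0 (multL_linear _)).
exists (c *: multL (f (multL x a1)) b1 + y) => a.
by rewrite !multL_linear ey -!fML multRL.
Qed.

Lemma extR_ex x b : exists y, forall a,
  multR (f a) y = multR (f (multL x a)) b.
Proof.
case: nf => _ _ sR; move: b.
apply: (spanning_ind sR) => [|c [a1 b1] v [y ey]].
  by exists 0 => a; rewrite !(lin0 (multR_linear _)).
exists (c *: multR (f (multR x a1)) b1 + y) => a.
by rewrite !multR_linear ey -!fMR multRL.
Qed.

Definition extL x b : B := sval (cid (extL_ex x b)).
Definition extR x b : B := sval (cid (extR_ex x b)).

Lemma extLP x b a : multL (f a) (extL x b) = multL (f (multR x a)) b.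
Proof. by rewrite /extL; case: cid. Qed.
Lemma extRP x b a : multR (f a) (extR x b) = multR (f (multL x a)) b.
Proof. by rewrite /extR; case: cid. Qed.

Lemma ext_is_mult x : is_multiplier (extL x, extR x).
Proof.
split=> [c b b'|c b b'|b b'|b b'|b] /=.
- by apply: nondegenerate_hom_eqL => a; rewrite multL_linear !extLP multL_linear.
- by apply: nondegenerate_hom_eqR => a; rewrite multR_linear !extRP multR_linear.
- by apply: nondegenerate_hom_eqL => a; rewrite !(extLP, multLM).
- by apply: nondegenerate_hom_eqR => a; rewrite !(extRP, multRM).
(* The mixed identity is linear in its second argument, so it is tested on f(a) b', where [extL x]
   takes the value f(x a) b'. *)
case: nf => _ sL _; apply: (spanning_eqfun _ _ sL) => [||[a b']].
- exact: nmul_linr.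
- move=> c b1 b2; rewrite -nmul_linr; congr (_ ** _).
  by apply: nondegenerate_hom_eqL => a; rewrite multL_linear !extLP multL_linear.
rewrite -multRL extRP multRL; congr (_ ** _).
by apply: nondegenerate_hom_eqL => a'; rewrite extLP -!fML multRL.
Qed.

Lemma extension_exists : exists F, is_extension f F.
Proof.
exists (fun x => mk_mult (ext_is_mult x)); split=> //; first split.
- move=> c x y; apply: (mult_eqL nB) => b; apply: nondegenerate_hom_eqL => a.
  by rewrite multLP multL_linear !extLP multRP lf multLP.
- move=> x y; apply: (mult_eqL nB) => b; apply: nondegenerate_hom_eqL => a.
  by rewrite !extLP.
- move=> a; apply: (mult_eqL nB) => b; apply: nondegenerate_hom_eqL => a'.
  by rewrite extLP fML.
Qed.

End ExtensionExistence.

Lemma extension_multL (K : fieldType) (A B : nualgType K)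
    (f : A -> multiplier B) F x a b :
  is_extension f F -> multL (F x) (multL (f a) b) = multL (f (multL x a)) b.
Proof.
move=> [_ [_ FM] Fe]; rewrite -[LHS]/(multL (F x ** f a) b).
by rewrite -Fe -FM mult_emb Fe.
Qed.

Lemma multLZ (K : fieldType) (A : nualgType K) c (x : multiplier A) a :
  multL (c *: x) a = c *: multL x a.
Proof. by []. Qed.

(** * Tensors and multipliers over the direct sum, componentwise *)

Section DirectSumTensor.
Variables (K : fieldType) (G : choiceType) (A : G -> nualgType K).
Local Notation AG := (dsum A).

Lemma dsum_nondegenerate : (forall p, nondegenerate (A p)) -> nondegenerate AG.
Proof.
move=> nA; split=> a h; apply: dsum_eq => p.
  apply: (nA p).1 => b; have /(congr1 (dproj p)) := h (dinj b).
  by rewrite -[LHS]/(dproj p (dinj b) ** a p) dinj_id.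
apply: (nA p).2 => b; have /(congr1 (dproj p)) := h (dinj b).
by rewrite -[LHS]/(a p ** dproj p (dinj b)) dinj_id.
Qed.

Lemma tensor_dsum_ind (P : tensor AG AG -> Prop) : P 0 ->
  (forall p q (w : tensor (A p) (A q)), P (inj2 w)) ->
  (forall x y, P x -> P y -> P (x + y)) -> forall t, P t.
Proof.
move=> P0 Pi PD t; have [s es] := proj2_decomp t.
rewrite (es (undup s)) ?undup_uniq // => [|p]; last by rewrite mem_undup.
by apply: big_ind => // p _; apply: big_ind.
Qed.

(** The projections [proj2 p q] separate points. Identities in M(A_G (x) A_G) are proved by
    exhibiting common components [z]. *)
Lemma mult_proj2_eq (x y : multiplier (tensor AG AG))
    (z : forall p q, multiplier (tensor (A p) (A q))) :
  (forall p q, intertwines (proj2 p q) x (z p q)) ->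
  (forall p q, intertwines (proj2 p q) y (z p q)) -> x = y.
Proof.
by move=> ix iy; apply: mult_eq => t; apply: proj2_eq => p q;
  rewrite ((ix _ _ _).1, (ix _ _ _).2) ((iy _ _ _).1, (iy _ _ _).2).
Qed.

Lemma intertwines_dproj p (a : AG) : intertwines (dproj p) (emb a) (emb (a p)).
Proof. by []. Qed.

Lemma intertwines_proj2_mtens p q (x y : multiplier AG) x' y' :
  intertwines (dproj p) x x' -> intertwines (dproj q) y y' ->
  intertwines (proj2 p q) (mtens x y) (mtens x' y').
Proof. by apply: intertwines_mtens; exact: dproj_linear. Qed.

Lemma intertwines_proj2_emb p q (t : tensor AG AG) :
  intertwines (proj2 p q) (emb t) (emb (proj2 p q t)).
Proof. by apply: intertwines_emb; exact: proj2_mul. Qed.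

Section Reindexing.
Variables sigma tau : G -> G -> G.
Hypothesis st_inj : forall p q p' q',
  sigma p q = sigma p' q' -> tau p q = tau p' q' -> (p, q) = (p', q').
Hypothesis st_surj : forall r s, exists p q, sigma p q = r /\ tau p q = s.
Variable f : forall p q,
  tensor (A (sigma p q)) (A (tau p q)) -> tensor (A p) (A q).
Hypotheses (lf : forall p q, linear (@f p q)).
Hypotheses (bf : forall p q, bijective (@f p q)).

(** Away from (p, q) both sides vanish: the left one by the support of [inj2], the right one because
    [st_inj] keeps the reindexed pairs distinct. *)
Let proj2_inj2_f p q p' q' w :
  proj2 p' q' (inj2 (@f p q w)) = f (proj2 (sigma p' q') (tau p' q') (inj2 w)).
Proof.
have [[<- <-]|ne] := eqVneq (p, q) (p', q'); first by rewrite !proj2_inj2.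
rewrite proj2_inj2_neq // proj2_inj2_neq; first by rewrite (lin0 (@lf p' q')).
by apply: contraNneq ne => -[es et]; apply/eqP/st_inj.
Qed.

(** The hypotheses make (p, q) |-> (sigma p q, tau p q) a permutation of G x G, so the maps [f] move
    components around bijectively and keep supports finite. *)
Lemma reindexing_bijection :
  exists T : tensor AG AG -> tensor AG AG, [/\ linear T, bijective T &
    forall p q t, proj2 p q (T t) = f (proj2 (sigma p q) (tau p q) t)].
Proof.
have pl := @proj2_linear K G A.
have ex t : exists y, forall p q,
    proj2 p q y = f (proj2 (sigma p q) (tau p q) t).
  elim/tensor_dsum_ind: t => [|r s|x y [x' ex] [y' ey]].
  - by exists 0 => p q; rewrite !(lin0 (pl _ _)) (lin0 (@lf _ _)).
  (* Replacing (r, s) by (sigma p q, tau p q) makes [f] applicable to [w] without a cast. *)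
  - have [p [q [<- <-]]] := st_surj r s => w; exists (inj2 (f w)) => p' q'.
    exact: proj2_inj2_f.
  - exists (x' + y') => p q; rewrite !(linD (pl _ _)) (linD (@lf _ _)).
    by rewrite ex ey.
pose T t := sval (cid (ex t)).
have TP p q t : proj2 p q (T t) = f (proj2 (sigma p q) (tau p q) t).
  by rewrite /T; case: cid.
have T_eq t y : (forall p q, proj2 p q y = f (proj2 (sigma p q) (tau p q) t)) ->
  T t = y by move=> e; apply: proj2_eq => p q; rewrite TP e.
have lT : linear T.
  by move=> c x y; apply: T_eq => p q; rewrite !pl !TP lf.
have injT : injective T.
  move=> t t' e; apply: proj2_eq => r s; have [p [q [<- <-]]] := st_surj r s.
  by apply: (bij_inj (@bf p q)); rewrite -!TP e.
have surjT y : exists t, T t = y.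
  elim/tensor_dsum_ind: y => [|p q w|_ _ [x <-] [y <-]].
  - by exists 0; exact: lin0.
  - have [g _ gK] := @bf p q; exists (inj2 (g w)); apply: T_eq => p' q'.
    by rewrite -proj2_inj2_f gK.
  - by exists (x + y); exact: linD.
exists T; split=> //; exists (fun y => sval (cid (surjT y))) => y.
  by apply: injT; case: cid.
by case: cid.
Qed.

End Reindexing.
End DirectSumTensor.

(** * The comultiplication of A_G and its canonical maps *)

Section DirectSumHopf.
Variables (K : fieldType) (G : groupType) (A : G -> nualgType K).
Variable D : forall p q : G, A (p * q)%g -> multiplier (tensor (A p) (A q)).
Hypothesis HD : multiplier_hopf_Gcoalgebra D.
Local Notation AG := (dsum A).
Local Notation DG := (comult_G D).

Let nA p : nondegenerate (A p). Proof. exact: (Gcoalg_nondegenerate HD). Qed.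
Let hD p q : is_hom (@D p q). Proof. exact: (Gcoalg_hom HD). Qed.
Let lD p q : linear (@D p q). Proof. by have [] := hD p q. Qed.

Lemma intertwines_comult_G p q (a : AG) :
  intertwines (proj2 p q) (DG a) (D (a (p * q)%g)).
Proof. exact: glueP. Qed.

Lemma comult_G_hom : is_hom DG.
Proof.
split=> [c a b|a b].
  apply: (mult_proj2_eq
      (z := fun p q => D (c *: a (p * q)%g + b (p * q)%g))) => p q.
    exact: intertwines_comult_G.
  rewrite lD.
  apply: intertwines_linear; first exact: proj2_linear.
    exact: intertwines_comult_G.
  exact: intertwines_comult_G.
apply: (mult_proj2_eq
    (z := fun p q => D (a (p * q)%g ** b (p * q)%g))) => p q.
  exact: intertwines_comult_G.
rewrite (hD p q).2.
by apply: intertwines_mul; exact: intertwines_comult_G.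
Qed.

Lemma intertwines_cov_right p q (a b : AG) :
  intertwines (proj2 p q) (DG a ** mtens 1%M (emb b))
    (D (a (p * q)%g) ** mtens 1%M (emb (b q))).
Proof.
apply: intertwines_mul; first exact: intertwines_comult_G.
by apply: intertwines_proj2_mtens; [exact: intertwines_one|exact: intertwines_dproj].
Qed.

Lemma intertwines_cov_left p q (a b : AG) :
  intertwines (proj2 p q) (mtens (emb a) 1%M ** DG b)
    (mtens (emb (a p)) 1%M ** D (b (p * q)%g)).
Proof.
apply: intertwines_mul; last exact: intertwines_comult_G.
by apply: intertwines_proj2_mtens; [exact: intertwines_dproj|exact: intertwines_one].
Qed.

(** The permutation (p, q) |-> (pq, q) has the inverse (r, s) |-> (r s^-1, s); both multipliers then
    have the components of [intertwines_cov_right]. *)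
Lemma comult_G_can_right : can_right_bij DG.
Proof.
have := Gcoalg_can_right HD; rewrite /can_right_bij => ex.
pose f p q := sval (cid (ex p q)).
have fP p q : [/\ linear (f p q), bijective (f p q) &
    forall a b, emb (f p q (tens a b)) = D a ** mtens 1%M (emb b)].
  by rewrite /f; case: cid.
have [|r s|p q|p q|T [lT bT TP]] := @reindexing_bijection K G A
  (fun p q => (p * q)%g) (fun _ q => q) _ _ f.
- by move=> p q p' q' /[swap] <- /mulIg ->.
- by exists (r * s^-1)%g, s; rewrite mulgVK.
- by case: (fP p q).
- by case: (fP p q).
exists T; split=> // a b.
apply: mult_proj2_eq => p q; last exact: intertwines_cov_right.
have [_ _ <-] := fP p q; rewrite -proj2_tens -TP.
exact: intertwines_proj2_emb.
Qed.

Lemma comult_G_can_left : can_left_bij DG.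
Proof.
have := Gcoalg_can_left HD; rewrite /can_left_bij => ex.
pose f p q := sval (cid (ex p q)).
have fP p q : [/\ linear (f p q), bijective (f p q) &
    forall a b, emb (f p q (tens a b)) = mtens (emb a) 1%M ** D b].
  by rewrite /f; case: cid.
have [|r s|p q|p q|T [lT bT TP]] := @reindexing_bijection K G A
  (fun p _ => p) (fun p q => (p * q)%g) _ _ f.
- by move=> p q p' q' <- /mulgI ->.
- by exists r, (r^-1 * s)%g; rewrite mulVKg.
- by case: (fP p q).
- by case: (fP p q).
exists T; split=> // a b.
apply: mult_proj2_eq => p q; last exact: intertwines_cov_left.
have [_ _ <-] := fP p q; rewrite -proj2_tens -TP.
exact: intertwines_proj2_emb.
Qed.

End DirectSumHopf.

(** * The associator of the tensor product *)

Section Associator.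
Variable K : fieldType.

Lemma tassoc_bilin (U V W : lmodType K) : bilin (fun (t : tensor U V) (w : W) =>
  tlift (fun u v => tens u (tens v w)) t).
Proof.
have [Dl Dr Zl Zr] := bilinP (tens_bilin U (tensor V W)).
have [Dl' Dr' Zl' Zr'] := bilinP (tens_bilin V W).
have b w : bilin (fun (u : U) (v : V) => tens u (tens v (w : W))).
  by apply: bilin_intro => *; rewrite ?(Dl, Zl) // (Dl', Zl') (Dr, Zr).
split=> [w|t]; first exact: tlift_linear.
apply: (@tlift_param K U V _ W) => // u v c x y.
by rewrite (tens_bilin _ _).2 (tens_bilin _ _).2.
Qed.

Lemma tassoc_linear (U V W : lmodType K) : linear (@tassoc K U V W).
Proof. exact/tlift_linear/tassoc_bilin. Qed.

Lemma tensor3_eqfun (U V W X : lmodType K) (f g : tensor (tensor U V) W -> X) :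
  linear f -> linear g ->
  (forall u v w, f (tens (tens u v) w) = g (tens (tens u v) w)) -> f =1 g.
Proof.
move=> lf lg e; apply: tensor_eqfun => // t w; move: t.
apply: tensor_eqfun => //.
- exact: (linear_comp ((tens_bilin (tensor U V) W).1 w)).
- exact: (linear_comp ((tens_bilin (tensor U V) W).1 w)).
Qed.

Lemma tassoc_tmap (U V W U' V' W' : lmodType K)
    (f : U -> U') (g : V -> V') (h : W -> W') t :
  linear f -> linear g -> linear h ->
  tmap f (tmap g h) (tassoc t) = tassoc (tmap (tmap f g) h t).
Proof.
move=> lf lg lh; have la := tassoc_linear.
have lgh := tmap_linear lg lh; have lfg := tmap_linear lf lg.
have lf_gh := tmap_linear lf lgh; have lfg_h := tmap_linear lfg lh.
move: t; apply: tensor3_eqfun => [||u v w].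
- exact: (linear_comp (@la _ _ _) lf_gh).
- exact: (linear_comp lfg_h (@la _ _ _)).
- by rewrite !(tassoc_tens, tmap_tens).
Qed.

Lemma tassoc_mul (A B C : nualgType K) (s t : tensor (tensor A B) C) :
  tassoc (s ** t : tensor (tensor A B) C) =
  tassoc s ** tassoc t :> tensor A (tensor B C).
Proof.
have la := @tassoc_linear A B C; move: s; apply: tensor3_eqfun => [||a b c].
- by apply: linear_comp => //; exact: nmul_linl.
- exact: (linear_comp la (nmul_linl _)).
move: t; apply: tensor3_eqfun => [||a' b' c'].
- by apply: linear_comp => //; exact: nmul_linr.
- exact: (linear_comp la (nmul_linr _)).
by rewrite !(tens_mul, tassoc_tens).
Qed.

Lemma tassoc_surj (U V W : lmodType K) (t : tensor U (tensor V W)) :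
  exists s, tassoc s = t.
Proof.
have la := @tassoc_linear U V W.
elim/tensor_ind: t => [|u t|_ _ [x <-] [y <-]].
- by exists 0; exact: lin0.
- elim/tensor_ind: t => [|v w|x y [x' ex] [y' ey]].
  + by exists 0; rewrite (lin0 la) (lin0 ((tens_bilin _ _).2 u)).
  + by exists (tens (tens u v) w); exact: tassoc_tens.
  + exists (x' + y'); rewrite (linD la) ex ey.
    by rewrite -(linD ((tens_bilin _ _).2 u)).
- by exists (x + y); exact: linD.
Qed.

End Associator.

(** * Coassociativity of A_G *)

Section DirectSumCoassociativity.
Variables (K : fieldType) (G : groupType) (A : G -> nualgType K).
Variable D : forall p q : G, A (p * q)%g -> multiplier (tensor (A p) (A q)).
Hypothesis HD : multiplier_hopf_Gcoalgebra D.
Local Notation AG := (dsum A).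
Local Notation DG := (comult_G D).

Lemma tensor3_dsum_eq (s t : tensor AG (tensor AG AG)) :
  (forall p q r, tmap (dproj p) (proj2 q r) s = tmap (dproj p) (proj2 q r) t) ->
  s = t.
Proof.
move=> e; apply/subr0_eq; pose g (qr : G * G) := @proj2 K G A qr.1 qr.2.
have lp := @dproj_linear K G A; have lg qr : linear (g qr) by exact: proj2_linear.
apply: (tmap_jointly_injective (f := @dproj K G A) (g := g)) => //.
- by move=> a h; apply: dsum_eq => p; exact: h.
- move=> u h; apply: proj2_eq => q r; rewrite (lin0 (proj2_linear q r)).
  exact: (h (q, r)).
move=> p [q r]; have l := tmap_linear (lp p) (lg (q, r)).
by rewrite -scaleN1r addrC l scaleN1r e addNr.
Qed.

Lemma proj2_surj p q (w : tensor (A p) (A q)) : exists t, proj2 p q t = w.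
Proof. by exists (inj2 w); exact: proj2_inj2. Qed.

(** As [b] is a dependent function, the cast along associativity carries its value at (pq)r to its
    value at p(qr). *)
Lemma comult_assoc_dsum p q r (b : AG) :
  comult_assoc D (b (p * q * r)%g) = D (b (p * (q * r))%g).
Proof. by rewrite /comult_assoc; congr D; case: _ / (esym _). Qed.

Lemma comult_G_coassoc : coassociative DG DG DG DG.
Proof.
move=> a b c s t es et.
have lp := @dproj_linear K G A; have l2 := @proj2_linear K G A.
have lDG : linear DG by case: (comult_G_hom HD).
have lD p q : linear (@D p q) by case: (Gcoalg_hom HD p q).
have le (B : nualgType K) : linear (@emb K B) by case: (emb_hom B).
(* The equations defining [s] and [t] descend to components, so coassociativity of the family
   applies to them. *)
have es_pqr p q r : emb (proj2 (p * q)%g r s) =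
    D (b (p * q * r)%g) ** mtens 1%M (emb (c r)).
  apply: (intertwines_fun (@proj2_surj _ _) (@intertwines_proj2_emb _ _ _ _ _ s)).
  by rewrite es; exact: intertwines_cov_right.
have et_pqr p q r : emb (proj2 p (q * r)%g t) =
    mtens (emb (a p)) 1%M ** comult_assoc D (b (p * q * r)%g).
  apply: (intertwines_fun (@proj2_surj _ _) (@intertwines_proj2_emb _ _ _ _ _ t)).
  by rewrite et comult_assoc_dsum; exact: intertwines_cov_left.
have coassoc p q r := Gcoalg_coassoc HD (es_pqr p q r) (et_pqr p q r).
(* [itL] and [itR] give the (p, q, r) components of the two sides for A_G: they are the two sides
   for the family. *)
have itL p q r : intertwines (tmap (proj2 p q) (dproj r))
    (mtens (mtens (emb a) 1%M) 1%M ** tensor_hom DG (@emb K AG) s)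
    (mtens (mtens (emb (a p)) 1%M) 1%M **
       tensor_hom (@D p q) (@emb K (A r)) (proj2 (p * q)%g r s)).
  apply: intertwines_mul.
    apply: intertwines_mtens; [exact: l2|exact: lp| |exact: intertwines_one].
    by apply: intertwines_proj2_mtens.
  apply: intertwines_tensor_hom; [exact: lDG|exact: le|exact: lD|exact: le|
    exact: lp|exact: lp|exact: l2|exact: lp|exact: intertwines_comult_G|].
  exact: intertwines_dproj.
have itR p q r : intertwines (tmap (dproj p) (proj2 q r))
    (tensor_hom (@emb K AG) DG t ** mtens 1%M (mtens 1%M (emb c)))
    (tensor_hom (@emb K (A p)) (@D q r) (proj2 p (q * r)%g t) **
       mtens 1%M (mtens 1%M (emb (c r)))).
  apply: intertwines_mul; last first.
    apply: intertwines_mtens; [exact: lp|exact: l2|exact: intertwines_one|].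
    by apply: intertwines_proj2_mtens.
  apply: intertwines_tensor_hom; [exact: le|exact: lDG|exact: le|exact: lD|
    exact: lp|exact: lp|exact: lp|exact: l2| |exact: intertwines_comult_G].
  exact: intertwines_dproj.
by move=> y; split; apply: tensor3_dsum_eq => p q r;
  rewrite tassoc_tmap // ((itL _ _ _ _).1, (itL _ _ _ _).2)
    ((coassoc _ _ _ _).1, (coassoc _ _ _ _).2) ((itR _ _ _ _).1, (itR _ _ _ _).2)
    tassoc_tmap.
Qed.

Lemma comult_G_hopf : multiplier_hopf_algebra DG.
Proof.
split.
- exact/dsum_nondegenerate/(Gcoalg_nondegenerate HD).
- exact: comult_G_hom.
(* Values of the canonical maps are the tensors that the covering conditions ask for. *)
- by have [T [_ _ TP]] := comult_G_can_right HD => a b; exists (T (tens a b)).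
- by have [T [_ _ TP]] := comult_G_can_left HD => a b; exists (T (tens a b)).
- exact: comult_G_coassoc.
- exact: comult_G_can_right.
- exact: comult_G_can_left.
Qed.

End DirectSumCoassociativity.

(** * Nondegeneracy of the comultiplication of a multiplier Hopf algebra *)

Section HopfNondegeneracy.
Variables (K : fieldType) (A : nualgType K).
Variable D : A -> multiplier (tensor A A).
Hypothesis HD : multiplier_hopf_algebra D.

Let nA : nondegenerate A. Proof. exact: (hopf_nondegenerate HD). Qed.
Let lD : linear D. Proof. by case: (hopf_hom HD). Qed.
Let le (B : nualgType K) : linear (@emb K B). Proof. by case: (emb_hom B). Qed.

Section CanonicalMaps.
Variables T T' : tensor A A -> tensor A A.
Hypotheses (lT : linear T) (lT' : linear T').
Hypothesis TP : forall a b, emb (T (tens a b)) = D a ** mtens 1%M (emb b).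
Hypothesis T'P : forall a b, emb (T' (tens a b)) = mtens (emb a) 1%M ** D b.

Let lid : linear (@idfun A). Proof. by []. Qed.
Let lT'a a : linear (fun b => T' (tens a b)).
Proof. exact: (linear_comp ((tens_bilin A A).2 a) lT'). Qed.

(** Shows that the left side of coassociativity is an actual tensor; [emb_can_right_leg] does the
    same for the right side. *)
Lemma emb_can_left_leg a (s : tensor A A) :
  emb (tmap (fun b => T' (tens a b)) (@idfun A) s) =
  mtens (mtens (emb a) 1%M) 1%M ** tensor_hom D (@emb K A) s.
Proof.
move: s; apply: tensor_eqfun => [||b c].
- exact: (linear_comp (tmap_linear (@lT'a a) lid) (@le _)).
- exact: (linear_comp (tensor_hom_linear lD (@le A)) (nmul_linr _)).
- rewrite tmap_tens // tensor_hom_tens // -mtens_emb T'P.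
  by rewrite mtens_mul mul1M.
Qed.

Lemma emb_can_right_leg (t : tensor A A) c :
  emb (tmap (@idfun A) T (tassoc (tens t c))) =
  tensor_hom (@emb K A) D t ** mtens 1%M (mtens 1%M (emb c)).
Proof.
have l1 := linear_comp ((tens_bilin (tensor A A) A).1 c) (tassoc_linear (W := A)).
move: t; apply: tensor_eqfun => [||x y].
- exact: (linear_comp (linear_comp l1 (tmap_linear lid lT))
    (@le _)).
- exact: (linear_comp (tensor_hom_linear (@le A) lD) (nmul_linl _)).
- rewrite tassoc_tens tmap_tens // tensor_hom_tens // -mtens_emb TP.
  by rewrite mtens_mul mulM1.
Qed.

(** For u = b (x) c, the two sides embed as the multipliers that coassociativity compares, and [emb]
    is injective. *)
Lemma can_maps_coassoc a (u : tensor A A) :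
  tassoc (tmap (fun b => T' (tens a b)) (@idfun A) (T u)) =
  tmap (@idfun A) T (tassoc (tmap (fun b => T' (tens a b)) (@idfun A) u)).
Proof.
have lPhi := tmap_linear (@lT'a a) lid; have la := @tassoc_linear K A A A.
have lIT := tmap_linear lid lT.
move: u; apply: tensor_eqfun => [||b c].
- exact: (linear_comp (linear_comp lT lPhi) la).
- exact: (linear_comp (linear_comp lPhi la) lIT).
have nAA := tensor_nondegenerate nA nA.
apply: (emb_inj (tensor_nondegenerate nA nAA)).
rewrite tmap_tens // emb_can_right_leg.
have /= i := hopf_coassoc HD (TP b c) (T'P a b).
apply: (intertwines_fun (h := @tassoc K A A A)); last exact: i.
  exact: tassoc_surj.
rewrite -emb_can_left_leg.
exact/(intertwines_emb (h := @tassoc K A A A))/tassoc_mul.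
Qed.

(** For u = b (x) c, both sides embed as (a (x) 1) D(b) (1 (x) c). *)
Lemma can_maps_mul a (u : tensor A A) :
  tmap (@idfun A) (tlift (@nmul K A))
    (tassoc (tmap (fun b => T' (tens a b)) (@idfun A) u)) =
  tmap (nmul a) (@idfun A) (T u).
Proof.
have lPhi := tmap_linear (@lT'a a) lid; have la := @tassoc_linear K A A A.
have lm := tlift_linear (@nmul_bilin K A).
have lIm := tmap_linear lid lm.
have lam := tmap_linear (@nmul_linr K A a) lid.
move: u; apply: tensor_eqfun => [||b c].
- exact: (linear_comp (linear_comp lPhi la) lIm).
- exact: (linear_comp lT lam).
rewrite tmap_tens //.
have -> (t : tensor A A) : tmap (@idfun A) (tlift (@nmul K A))
    (tassoc (tens t c)) = tmap (@idfun A) (nmul^~ c) t.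
  move: t; apply: tensor_eqfun => [||x y].
  - exact: (linear_comp (linear_comp ((tens_bilin _ _).1 c) la) lIm).
  - exact: (tmap_linear lid (nmul_linl c)).
  - rewrite tassoc_tens !tmap_tens //; last exact: nmul_linl.
    by rewrite tlift_tens //; exact: nmul_bilin.
have e1 (t : tensor A A) : emb (tmap (@idfun A) (nmul^~ c) t) =
    emb t ** mtens 1%M (emb c).
  by rewrite emb_mult.
have e2 (t : tensor A A) : emb (tmap (nmul a) (@idfun A) t) =
    mtens (emb a) 1%M ** emb t.
  by rewrite mult_emb.
apply: (emb_inj (tensor_nondegenerate nA nA)).
by rewrite e1 e2 T'P TP nmulA.
Qed.

End CanonicalMaps.

Lemma hopf_square : spanning (fun ab : A * A => ab.1 ** ab.2).
Proof.
move=> c; change (in_span (fun ab : A * A => ab.1 ** ab.2) c).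
have [T [lT [T1 TK T1K] TP]] := hopf_can_right HD.
have [T' [lT' _ T'P]] := hopf_can_left HD.
(* If all products vanish, nondegeneracy forces c = 0, the empty sum. *)
have [[a [b /eqP ab0]]|ab0] := pselect (exists a b : A, a ** b <> 0); last first.
  exists [::]; rewrite big_nil; apply: nA.2 => b.
  by apply: contrapT => cb; apply: ab0; exists c, b.
have lT1 : linear T1 by move=> k x y; apply: (can_inj TK); rewrite lT !T1K.
have lid : linear (@idfun A) by [].
have lm := tlift_linear (@nmul_bilin K A).
have [w [lw w1]] := exists_functional ab0.
(* [E (a (x) c)] is [eps(a) c], where [eps] would be the counit. *)
pose E x := tlift (@nmul K A) (T1 x).
have lE : linear E := linear_comp lT1 lm.
(* Write b (x) c as T(T1(b (x) c)). Moving [T'] past [T] by [can_maps_coassoc] lets [E] cancel [T]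
   and leaves a multiplication, which [can_maps_mul] evaluates. *)
have key : tmap (@idfun A) E (tassoc (tens (T' (tens a b)) c)) = tens (a ** b) c.
  have lT'a := linear_comp ((tens_bilin A A).2 a) lT'.
  have <- : tmap (fun b => T' (tens a b)) (@idfun A) (T (T1 (tens b c))) =
    tens (T' (tens a b)) c by rewrite T1K tmap_tens.
  rewrite (can_maps_coassoc lT lT' TP T'P).
  set z := tassoc _.
  have -> : tmap (@idfun A) E (tmap (@idfun A) T z) =
      tmap (@idfun A) (tlift (@nmul K A)) z.
    move: (z); apply: tensor_eqfun => [||x y].
    - exact: (linear_comp (tmap_linear lid lT) (tmap_linear lid lE)).
    - exact: tmap_linear.
    - by rewrite !tmap_tens // /E TK.
  rewrite /z (can_maps_mul lT lT' TP T'P) T1K tmap_tens //.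
  exact: nmul_linr.
have -> : c = slicel w (tens (a ** b) c).
  by rewrite slicel_tens // w1 scale1r.
(* Slicing by [w] turns each x (x) E(y) into w(x) E(y), and E(y) is a sum of products. *)
rewrite -key; elim/tensor_ind: (tassoc _) => [|x y|y z].
- rewrite (lin0 (tmap_linear lid lE)) (lin0 (slicel_linear lw)).
  exact: in_span0.
- rewrite tmap_tens // slicel_tens //; apply: in_spanZ; rewrite /E.
  elim/tensor_ind: (T1 y) => [|u v|u v].
  + by rewrite (lin0 lm); exact: in_span0.
  + rewrite tlift_tens; last exact: nmul_bilin.
    exact: (in_span_gen (fun ab : A * A => ab.1 ** ab.2) (u, v)).
  + by rewrite (linD lm); exact: in_spanD.
- rewrite (linD (tmap_linear lid lE)) (linD (slicel_linear lw)).
  exact: in_spanD.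
Qed.

(** Every tensor is a sum of values T(a (x) b), and by [hopf_square] one may take a = a' a''; then
    T(a' a'' (x) b) = D(a') T(a'' (x) b). The other side uses [T'] in the same way. *)
Lemma hopf_comult_nondegenerate : nondegenerate_hom D.
Proof.
have [T [lT [T1 _ T1K] TP]] := hopf_can_right HD.
have [T' [lT' [T1' _ T1K'] T'P]] := hopf_can_left HD.
have nAA := tensor_nondegenerate nA nA.
have DM := (hopf_hom HD).2.
split; first exact: (hopf_hom HD).
- move=> z; change (in_span (fun ab : A * tensor A A => multL (D ab.1) ab.2) z).
  rewrite -[z]T1K; elim/tensor_ind: (T1 z) => [|a b|x y].
  + by rewrite (lin0 lT); exact: in_span0.
  + move: a; apply: (spanning_ind hopf_square).
      rewrite (lin0 ((tens_bilin _ _).1 b)) (lin0 lT); exact: in_span0.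
    move=> c [a' a] v iv; rewrite (tens_bilin _ _).1 lT.
    apply: in_spanD => //; apply: in_spanZ.
    suff -> : T (tens (a' ** a) b) = multL (D a') (T (tens a b)).
      exact: (in_span_gen (fun ab : A * tensor A A => multL (D ab.1) ab.2) (a', _)).
    by apply: (emb_inj nAA); rewrite -mult_emb !TP DM nmulA.
  + by rewrite (linD lT); exact: in_spanD.
- move=> z; change (in_span (fun ab : A * tensor A A => multR (D ab.1) ab.2) z).
  rewrite -[z]T1K'; elim/tensor_ind: (T1' z) => [|a b|x y].
  + by rewrite (lin0 lT'); exact: in_span0.
  + move: b; apply: (spanning_ind hopf_square).
      rewrite (lin0 ((tens_bilin _ _).2 a)) (lin0 lT'); exact: in_span0.
    move=> c [b b'] v iv; rewrite (tens_bilin _ _).2 lT'.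
    apply: in_spanD => //; apply: in_spanZ.
    suff -> : T' (tens a (b ** b')) = multR (D b') (T' (tens a b)).
      exact: (in_span_gen (fun ab : A * tensor A A => multR (D ab.1) ab.2) (b', _)).
    by apply: (emb_inj nAA); rewrite -emb_mult !T'P DM nmulA.
  + by rewrite (linD lT'); exact: in_spanD.
Qed.

End HopfNondegeneracy.

(** * The homomorphism gamma from K(G) to M(A_G) *)

Section FunctionMultipliers.
Variables (K : fieldType) (G : choiceType) (A : G -> nualgType K).
Local Notation AG := (dsum A).
Local Notation KG := (fin_functions K G).
Implicit Types (f g : KG) (a b : AG).

Lemma dsum_scale_finite f a :
  finite_set [set p | (f p : K) *: a p != 0]%classic.
Proof.
apply: sub_finite_set (dsum_finite a) => p /=.
by apply: contraNN => /eqP ->; rewrite scaler0.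
Qed.

Definition dsum_scale f a : AG := Dsum (dsum_scale_finite f a).

Lemma dsum_scale_is_mult f : is_multiplier (dsum_scale f, dsum_scale f).
Proof.
split=> [c a b|c a b|a b|a b|a b] /=; apply: dsum_eq => p.
- exact: scale_linear.
- exact: scale_linear.
- by have [_ _ Zl _] := bilinP (@nmul_bilin K (A p)); exact/esym/Zl.
- by have [_ _ _ Zr] := bilinP (@nmul_bilin K (A p)); exact/esym/Zr.
- have [_ _ Zl Zr] := bilinP (@nmul_bilin K (A p)).
  by rewrite -[LHS]/(((f p : K) *: a p) ** b p) Zl -Zr.
Qed.

Definition fun_mult f : multiplier AG := mk_mult (dsum_scale_is_mult f).

Lemma fun_mult_hom : is_hom fun_mult.
Proof.
split=> [c f g|f g]; apply: mult_eq => a; apply: dsum_eq => p.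
- exact: etrans (scalerDl _ _ _) (congr2 _ (esym (scalerA _ _ _)) erefl).
- exact: etrans (scalerDl _ _ _) (congr2 _ (esym (scalerA _ _ _)) erefl).
- exact/esym/scalerA.
- by rewrite -[RHS]/((g p : K) *: ((f p : K) *: a p)) scalerA mulrC.
Qed.

(** Take the indicator function of the finite support of [a]. These local units make [fun_mult] and
    its tensor square nondegenerate. *)
Lemma dsum_local_unit a : exists f, dsum_scale f a = a.
Proof.
have fin : finite_set [set p | ((a p != 0)%:R : K^o) != 0]%classic.
  apply: sub_finite_set (dsum_finite a) => p /=.
  by case: (a p != 0) => //; rewrite eqxx.
exists (Dsum fin); apply: dsum_eq => p /=.
by have [->|_] := eqVneq (a p) 0; rewrite ?scaler0 ?scale1r.
Qed.

Lemma fun_mult_nondegenerate : nondegenerate_hom fun_mult.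
Proof.
split; first exact: fun_mult_hom.
- move=> a; have [f fa] := dsum_local_unit a.
  rewrite -fa.
  exact: (in_span_gen (fun ab : KG * AG => multL (fun_mult ab.1) ab.2) (f, a)).
- move=> a; have [f fa] := dsum_local_unit a.
  rewrite -fa.
  exact: (in_span_gen (fun ab : KG * AG => multR (fun_mult ab.1) ab.2) (f, a)).
Qed.

Lemma fun_mult_tensor_nondegenerate :
  nondegenerate_hom (tensor_hom fun_mult fun_mult).
Proof.
have hf := fun_mult_hom; have [lf _] := hf.
split; first exact: tensor_hom_is_hom.
- move=> t; change (in_span (fun z : tensor KG KG * tensor AG AG =>
    multL (tensor_hom fun_mult fun_mult z.1) z.2) t).
  elim/tensor_ind: t => [|a b|x y]; [exact: in_span0| |exact: in_spanD].
  have [f fa] := dsum_local_unit a; have [g gb] := dsum_local_unit b.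
  have -> : tens a b = multL (tensor_hom fun_mult fun_mult (tens f g)) (tens a b).
    by rewrite tensor_hom_tens // multL_mtens; congr tens; exact/esym.
  exact: (in_span_gen (fun z : tensor KG KG * tensor AG AG =>
    multL (tensor_hom fun_mult fun_mult z.1) z.2) (tens f g, _)).
- move=> t; change (in_span (fun z : tensor KG KG * tensor AG AG =>
    multR (tensor_hom fun_mult fun_mult z.1) z.2) t).
  elim/tensor_ind: t => [|a b|x y]; [exact: in_span0| |exact: in_spanD].
  have [f fa] := dsum_local_unit a; have [g gb] := dsum_local_unit b.
  have -> : tens a b = multR (tensor_hom fun_mult fun_mult (tens f g)) (tens a b).
    by rewrite tensor_hom_tens // multR_mtens; congr tens; exact/esym.
  exact: (in_span_gen (fun z : tensor KG KG * tensor AG AG =>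
    multR (tensor_hom fun_mult fun_mult z.1) z.2) (tens f g, _)).
Qed.

(** The left and right actions of [fun_mult f] are the same map, which moves freely between factors:
    b (f (x a)) = f ((b x) a) = (b x) (f a) = b (x (f a)). *)
Lemma fun_mult_central f (x : multiplier AG) : nondegenerate AG ->
  fun_mult f ** x = x ** fun_mult f.
Proof.
move=> nAG.
have mE a b : dsum_scale f a ** b = a ** dsum_scale f b.
  exact: (multRL (fun_mult f)).
have mL a b : dsum_scale f (a ** b) = dsum_scale f a ** b.
  exact: (multLM (fun_mult f)).
apply: (mult_eqL nAG) => a; apply: (nondegenerate_eql nAG) => b.
rewrite -[LHS]/(b ** dsum_scale f (multL x a)).
rewrite -[RHS]/(b ** multL x (dsum_scale f a)).
by rewrite -mE -mL -!multRL mL mE.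
Qed.

(** The component of [s] at (p, q) lies in K (x) K; the product of K turns it into the scalar by
    which [s] acts there. *)
Lemma proj2_fun_mult p q (s : tensor KG KG) (t : tensor AG AG) :
  proj2 p q (multL (tensor_hom fun_mult fun_mult s) t) =
  (tlift (@nmul K K^o) (proj2 p q s) : K) *: proj2 p q t.
Proof.
have [lf _] := fun_mult_hom; have lh := tensor_hom_linear lf lf.
have pl := @proj2_linear K G A p q; 
have pl' := @proj2_linear K G (fun=> K^o : nualgType K) p q.
have lm := tlift_linear (@nmul_bilin K K^o).
elim/tensor_ind: s => [|f g|s s' es es'].
- by rewrite (lin0 lh) (lin0 pl') (lin0 lm) scale0r (lin0 pl).
- rewrite tensor_hom_tens // proj2_tens tlift_tens; last exact: nmul_bilin.
  elim/tensor_ind: t => [|a b|t t' et et'].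
  + by rewrite (lin0 (multL_linear _)) (lin0 pl) scaler0.
  + rewrite multL_mtens !proj2_tens.
    have [_ _ Zl Zr] := bilinP (tens_bilin (A p) (A q)).
    by rewrite -[LHS]/(tens ((f p : K) *: a p) ((g q : K) *: b q)) Zl Zr scalerA.
  + by rewrite (linD (multL_linear _)) !(linD pl) et et' scalerDr.
- rewrite (linD lh) (linD pl') (linD lm) scalerDl -es -es'.
  by rewrite -(linD pl).
Qed.

End FunctionMultipliers.

(** * Compatibility of gamma with the comultiplications *)

Section Compatibility.
Variables (K : fieldType) (G : groupType) (A : G -> nualgType K).
Variable D : forall p q : G, A (p * q)%g -> multiplier (tensor (A p) (A q)).
Hypothesis HD : multiplier_hopf_Gcoalgebra D.
Local Notation AG := (dsum A).
Local Notation KG := (fin_functions K G).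

Let acts_as (f : KG) (x : multiplier (tensor AG AG)) : Prop :=
  forall p q t, proj2 p q (multL x t) = (f (p * q)%g : K) *: proj2 p q t.

(** On a spanning element Delta_G(a) t the extension gives Delta_G(f a) t, and linearity of [D] at
    (p, q) takes out the value f(pq). *)
Let comult_ext_acts F f :
  is_extension (comult_G D) F -> acts_as f (F (fun_mult A f)).
Proof.
move=> eF p q; have [[_ sL _] _ _] := eF.
have pl := @proj2_linear K G A p q.
apply: (spanning_eqfun _ _ sL) => [||[a t]].
- exact: (linear_comp (multL_linear _) pl).
- exact: (linear_comp pl (scale_linear (f (p * q)%g : K))).
rewrite (extension_multL _ _ _ eF).
have e := intertwines_comult_G D p q; rewrite (e _ _).1 (e _ _).1.
exact: (congr1 (fun x => multL x _) (linZ (Gcoalg_hom HD p q).1 _ _)).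
Qed.

(** On spanning elements [comult_fun f] first multiplies the component of [s] at (p, q) by f(pq),
    and [proj2_fun_mult] passes this scalar on to [t]. *)
Let tensor_ext_acts F f :
  is_extension (tensor_hom (@fun_mult K G A) (@fun_mult K G A)) F ->
  acts_as f (F (comult_fun f)).
Proof.
move=> eF p q; have [[_ sL _] _ _] := eF.
have pl := @proj2_linear K G A p q.
apply: (spanning_eqfun _ _ sL) => [||[s t]].
- exact: (linear_comp (multL_linear _) pl).
- exact: (linear_comp pl (scale_linear (f (p * q)%g : K))).
rewrite (extension_multL _ _ _ eF).
rewrite !proj2_fun_mult scalerA; congr (_ *: _).
rewrite proj2_glueL multLZ.
by rewrite (linZ (tlift_linear (@nmul_bilin K K^o))).
Qed.

Lemma comult_fun_mult F F' f : is_extension (comult_G D) F ->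
  is_extension (tensor_hom (@fun_mult K G A) (@fun_mult K G A)) F' ->
  F (fun_mult A f) = F' (comult_fun f).
Proof.
move=> eF eF'; have nAG := dsum_nondegenerate (Gcoalg_nondegenerate HD).
apply: (mult_eqL (tensor_nondegenerate nAG nAG)) => t; apply: proj2_eq => p q.
by rewrite (comult_ext_acts f eF) (tensor_ext_acts f eF').
Qed.

End Compatibility.

Theorem proposition4p1 (R : realType) (G : groupType)
    (A : G -> nualgType R[i])
    (Delta : forall p q : G, A (p * q)%g -> multiplier (tensor (A p) (A q))) :
  multiplier_hopf_Gcoalgebra Delta ->
  multiplier_hopf_algebra (comult_G Delta) /\
  exists gamma : fin_functions R[i] G -> multiplier (dsum A),
    [/\ nondegenerate_hom gamma,
        forall f x, gamma f ** x = x ** gamma f &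
        exists (Delta_ext : multiplier (dsum A) ->
                            multiplier (tensor (dsum A) (dsum A)))
               (gamma2_ext : multiplier (tensor (fin_functions R[i] G)
                                                (fin_functions R[i] G)) ->
                             multiplier (tensor (dsum A) (dsum A))),
          [/\ is_extension (comult_G Delta) Delta_ext,
              is_extension (tensor_hom gamma gamma) gamma2_ext &
              forall f, Delta_ext (gamma f) = gamma2_ext (comult_fun f)]].
Proof.
move=> HD; have hopf := comult_G_hopf HD; split=> //.
have nAG := hopf_nondegenerate hopf; have nAGG := tensor_nondegenerate nAG nAG.
exists (@fun_mult _ G A); split.
- exact: fun_mult_nondegenerate.
- by move=> f x; exact: fun_mult_central.
have [F eF] := extension_exists nAGG (hopf_comult_nondegenerate hopf).
have [F' eF'] := extension_exists nAGG (@fun_mult_tensor_nondegenerate _ G A).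
exists F, F'; split; [exact: eF|exact: eF'|] => f.
exact: (comult_fun_mult HD f eF eF').
Qed.
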